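(* Let $h$ be a nonnegative definite form in $\mathcal H$ with associated operator $H$, let $X:\mathbb C^n\to\mathcal H$ be an isometry whose ($n$-dimensional) range $\operatorname{ran}(P)$, $P=XX^*$, is contained in $\mathcal Q(h)$, and let $H'$ be the block diagonal part of $H$ with respect to $\operatorname{ran}(P)$. Let $\mu_1\le\cdots\le\mu_n$ be the eigenvalues of $\Xi=(H^{1/2}X)^*H^{1/2}X$, and assume $\mu_n<\lambda_e(H)$ and $\sin\Theta_p<1$, where $\sin\Theta_p:=\sin\Theta_p(H^{1/2}\mathcal X,\mathsf{inv}(H^{1/2})\mathcal X)$ with $\mathcal X=\operatorname{ran}(P)$. Let $\lambda_{i_1}\le\cdots\le\lambda_{i_n}$ be the eigenvalues of $H$ approximated by the Ritz values, where $i_{(\cdot)}:\mathbb N\to\mathbb N$ is a permutation, i.e. $$|\lambda_{i_j}-\mu_j|\le\mu_j\sin\Theta_p,\qquad |\lambda_{i_j}-\mu_j|\le\lambda_{i_j}\frac{\sin\Theta_p}{1-\sin\Theta_p},\qquad j=1,\dots,n$$ (such eigenvalues exist under these assumptions). Let $u_1,\dots,u_n\in\operatorname{ran}(P)$ be mutually orthogonal unit eigenvectors belonging to the eigenvalues $\mu_1,\dots,\mu_n$ of $H'P$. Then there exist mutually orthogonal unit eigenvectors $v_1,\dots,v_n$ of $H$, belonging to the eigenvalues $\lambda_{i_1},\dots,\lambda_{i_n}$, such that for $j=1,\dots,n$ $$\|v_j-u_j\|\le\frac{\sqrt2\,\sin\Theta_p}{\sqrt{1-\sin\Theta_p}}\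 \max_{k\ne j}\frac{\sqrt{\mu_j\lambda_{i_k}}}{|\lambda_{i_k}-\mu_j|},$$ where $k$ ranges over all indices $k\in\mathbb N$, $k\neq j$, and the right-hand side is read as $+\infty$ if a denominator vanishes.
   Context: $\mathcal H$ is a Hilbert space. A nonnegative form $h$ is a closed symmetric form with domain $\mathcal Q(h)$ dense in $\mathcal H$ and $h[u]:=h(u,u)\ge0$. Its associated operator $H$ is the nonnegative selfadjoint operator with $\mathcal D(H^{1/2})=\mathcal Q(h)$ and $h(u,v)=(H^{1/2}u,H^{1/2}v)$. The form is nonnegative definite if $\lambda_e(H)>0$, where $\lambda_e(H)$ is the infimum of the essential spectrum of $H$ ($+\infty$ if it is empty). The discrete eigenvalues of $H$, counted with multiplicity, are denoted $0\le\lambda_1\le\lambda_2\le\cdots<\lambda_e(H)$. The block diagonal part of $h$ is $h'(u,v)=h(Pu,Pv)+h((I-P)u,(I-P)v)$, $u,v\in\mathcal Q(h)$; it is a closed nonnegative form, and $H'$ denotes the nonnegative selfadjoint operator it defines, $h'(u,v)=(H'^{1/2}u,H'^{1/2}v)$. One has $\operatorname{ran}(X)\subset\mathcal D(H')$ and $H'X=X\Xi$, so the $\mu_j$ are the eigenvalues of $H'P$ on $\operatorname{ran}(P)$. The inverse image is $\mathsf{inv}(H^{1/2})\mathcal X=\{x\in\mathcal D(H^{1/2}):H^{1/2}x\in\mathcal X\}$. For finite dimensional subspaces with orthogonal projections $P_1,P_2$, the maximal principal angle is $\Theta_p=\arcsin\min\{\|P_1(I-P_2)\|,\|P_2(I-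P_1)\|\}$.
   Formalization: If H has only finitely many discrete eigenvalues, the missing λ_k are read as λ_e(H) (ratio 0 if λ_e = +∞) and so enter the maximum over k; without this the bound is undefined or false, e.g. with one discrete eigenvalue and nonempty essential spectrum. The maximum is read as a supremum. *)

(* Defs.v *)
From HB Require Import structures.
From mathcomp Require Import all_boot all_order all_algebra.
From mathcomp Require Import sesquilinear complex.
From mathcomp Require Import all_classical all_reals all_analysis.
Set Implicit Arguments.
Unset Strict Implicit.
Unset Printing Implicit Defensive.
Import Order.TTheory GRing.Theory Num.Theory.
Import numFieldNormedType.Exports.
Local Open Scope classical_set_scope.
Local Open Scope ring_scope.
Local Open Scope complex_scope.

(* The inner product is linear in its first argument.  No separability and no
   infinite-dimensionality is assumed. *)
Record hilbertSpace (R : realType) := Hilbert {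
  hcarrier :> completeNormedModType R[i] ;
  hdot : {dot hcarrier for (@Num.conj R[i])} ;
  hdotE : forall x : hcarrier, hdot x x = `|x| ^+ 2 }.

Arguments hdot {R} _.
Notation "''[' u , v ]" := (hdot _ u v)
  (format "''[' u ,  v ]") : ring_scope.

Section Operators.
Variables (R : realType) (E : hilbertSpace R).

(* `|x| lives in R[i]; this is the same number in R. *)
Definition nrm (x : E) : R := complex.Re `|x|.

Definition lin_subspace (V : set E) :=
  V 0 /\ forall (a : R[i]) x y, V x -> V y -> V (a *: x + y).

Definition orthonormal_family n (u : 'I_n -> E) :=
  forall j k, '[u j, u k] = (j == k)%:R.

Definition has_dim (V : set E) (m : nat) :=
  exists b : 'I_m -> E,
    (forall a : 'I_m -> R[i], \sum_l a l *: b l = 0 -> forall l, a l = 0) /\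
    V = [set \sum_l a l *: b l | a in [set: 'I_m -> R[i]]].

(* Unbounded operators; the values of [op_fun] outside [odom] are irrelevant. *)
Record operator := Operator { odom : set E ; op_fun :> E -> E }.

Definition op_eq (A B : operator) :=
  odom A = odom B /\ forall x, odom A x -> A x = B x.

Definition op_linear (A : operator) :=
  lin_subspace (odom A) /\
  forall (a : R[i]) x y, odom A x -> odom A y -> A (a *: x + y) = a *: A x + A y.

(* The last clause is A* = A: (y, z) is in the graph of A* iff it is in the
   graph of A. *)
Definition selfadjoint (A : operator) :=
  [/\ op_linear A, dense (odom A) &
    forall y z, (forall x, odom A x -> '[A x, y] = '[x, z]) <->
                (odom A y /\ A y = z)].

(* In R[i], 0 <= w means that w is real and nonnegative. *)
Definition nonneg_selfadjoint (A : operator) :=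
  selfadjoint A /\ forall x, odom A x -> 0 <= '[A x, x].

Definition op_square (A : operator) : operator :=
  Operator [set x | odom A x /\ odom A (A x)] (fun x => A (A x)).

Definition op_precomp (A : operator) (T : E -> E) : operator :=
  Operator [set x | odom A (T x)] (fun x => A (T x)).

Definition inv_image (A : operator) (V : set E) : set E :=
  [set x | odom A x /\ V (A x)].

Definition op_eigenspace (A : operator) (z : R[i]) : set E :=
  [set x | odom A x /\ A x = z *: x].

Definition resolvent_set (A : operator) : set R[i] :=
  [set z | exists B : {linear E -> E},
     [/\ continuous (B : E -> E),
         forall x, odom A x -> B (A x - z *: x) = x &
         forall y, odom A (B y) /\ A (B y) - z *: B y = y]].

Definition spectrum (A : operator) : set R[i] := ~` resolvent_set A.

Definition discrete_spectrum (A : operator) : set R[i] :=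
  [set z | isolated (spectrum A : set (R[i] : numFieldType)) z /\
           exists2 m, (0 < m)%N & has_dim (op_eigenspace A z) m].

Definition essential_spectrum (A : operator) : set R[i] :=
  spectrum A `\` discrete_spectrum A.

Definition lambda_e (A : operator) : \bar R :=
  ereal_inf [set t%:E | t in [set t : R | essential_spectrum A t%:C]].

(* [lam] lists the eigenvalues below lambda_e A in nondecreasing order with
   multiplicity.  If there are only finitely many of them (in particular in
   finite dimension), the remaining entries are forced to be lambda_e A, as in
   the min-max principle, so that the index always ranges over all of nat. *)
Definition discrete_eigenvalues (A : operator) (lam : nat -> \bar R) :=
  [/\ nondecreasing_seq lam,
      forall k, (0 <= lam k <= lambda_e A)%E &
      forall t : R, (t%:E < lambda_e A)%E ->
        exists m, has_dim (op_eigenspace A t%:C) m /\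
                  ([set k | lam k = t%:E] #= `I_m)%card].

Record hform := HForm { fdom : set E ; fapp :> E -> E -> R[i] }.

Definition qform (h : hform) (u : E) : R := complex.Re (h u u).

Definition closed_form (h : hform) :=
  forall (x_ : nat -> E) (x : E),
    (forall k, fdom h (x_ k)) -> x_ k @[k --> \oo] --> x ->
    (forall e : R, 0 < e -> \forall k & l \near \oo, qform h (x_ k - x_ l) < e) ->
    fdom h x /\ qform h (x_ k - x) @[k --> \oo] --> (0 : R).

Definition nonneg_form (h : hform) :=
  [/\ lin_subspace (fdom h) /\ dense (fdom h),
      forall (a : R[i]) x y z, fdom h x -> fdom h y -> fdom h z ->
        h (a *: x + y) z = a * h x z + h y z,
      forall x y, fdom h x -> fdom h y -> h y x = (h x y)^*,
      forall x, fdom h x -> 0 <= h x x &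
      closed_form h].

(* [A] is the operator associated with [h], and [As] is A^{1/2}. *)
Definition form_operator (h : hform) (A As : operator) :=
  [/\ nonneg_selfadjoint A,
      nonneg_selfadjoint As /\ op_eq (op_square As) A,
      odom As = fdom h &
      forall u v, fdom h u -> fdom h v -> h u v = '[As u, As v]].

Definition nonneg_definite (h : hform) (A : operator) :=
  nonneg_form h /\ (0 < lambda_e A)%E.

Definition block_diagonal (h : hform) (P : E -> E) : hform :=
  HForm (fdom h) (fun u v => h (P u) (P v) + h (u - P u) (v - P v)).

(* Orthogonal projection onto V (meaningful for V closed, e.g. of finite
   dimension). *)
Definition oproj (V : set E) (x : E) : E :=
  xget 0 [set y | V y /\ forall z, V z -> '[x - y, z] = 0].

Definition opnorm (T : E -> E) : R :=
  sup [set nrm (T x) | x in [set x : E | nrm x <= 1]].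

Definition max_principal_angle (V W : set E) : R :=
  asin (Num.min (opnorm (fun x => oproj V (x - oproj W x)))
                (opnorm (fun x => oproj W (x - oproj V x)))).

Definition cdot n (a b : 'cV[R[i]]_n) : R[i] := \sum_l a l 0 * (b l 0)^*.

Definition isometric n (X : 'cV[R[i]]_n -> E) :=
  forall a b, '[X a, X b] = cdot a b.

(* T* for a linear T : C^n -> E, i.e. '[T a, x] = cdot a (adj T x). *)
Definition adj n (T : 'cV[R[i]]_n -> E) (x : E) : 'cV[R[i]]_n :=
  \col_l '[x, T (delta_mx l 0)].

Definition range_proj n (X : 'cV[R[i]]_n -> E) (x : E) : E := X (adj X x).

(* Matrix of T* T in the standard basis. *)
Definition gram n (T : 'cV[R[i]]_n -> E) : 'M[R[i]]_n :=
  \matrix_(k, l) adj T (T (delta_mx l 0)) k 0.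

Definition sorted_eigenvalues n (M : 'M[R[i]]_n) (mu : 'I_n -> R) :=
  char_poly M = \prod_j ('X - ((mu j)%:C)%:P) /\
  forall j k : 'I_n, (j <= k)%N -> mu j <= mu k.

End Operators.

Section Bound.
Variable R : realType.

(* sqrt (mu * l) / |l - mu|, with its limit 0 at l = +oo. *)
Definition gap_ratio (mu : R) (l : \bar R) : \bar R :=
  if l is r%:E then (Num.sqrt (mu * r) / `|r - mu|)%:E else 0%E.

(* [l k] stands for lambda_{i_k}; the value is +oo as soon as one of the
   denominators vanishes, even if the prefactor is 0. *)
Definition eigenvector_bound (s mu : R) (l : nat -> \bar R) (j : nat) : \bar R :=
  if `[< exists2 k, k != j & l k = mu%:E >] then +oo%E
  else ((Num.sqrt 2 * s / Num.sqrt (1 - s))%:E *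
        ereal_sup [set gap_ratio mu (l k) | k in [set k | k != j]])%E.

End Bound.

(* Main.v *)
(* Write [u = u_j], [mu = mu_j], let [v] be a unit eigenvector of [H] for
   [l = lambda_{i_j}] with [(u, v) >= 0], and let [r = u - (u, v) v].

   If [l] is a multiple eigenvalue, the index [k <> j] with [lambda_{i_k} = l]
   makes the right-hand side at least [sqrt 2 >= |v - u|].  Otherwise [r] is
   orthogonal to the eigenspace of [l], and [|v - u|^2 <= 2 |r|^2].

   Solve [(H - mu) f = r].  Since [u] is a Ritz vector,
   [|r|^2 = h(u, f) - mu (u, f) = h(u, f - P f)], which is at most
   [s sqrt(mu) sqrt(h[f - P f])]: the sine of the principal angle bounds the
   cosine of the angle between [H^{1/2} ran P] and the image under [H^{1/2}] of
   the orthogonal complement of [ran P].  The same bound gives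
   [(1 - s) h[f - P f] <= h[f]].  Finally [mu h[f] <= G^2 |r|^2], where [G] is
   the supremum of [sqrt(mu x) / |x - mu|] over the spectrum of [H] without [l].

   The last inequality is obtained without the spectral theorem: for a symmetric
   operator [T] whose resolvent exists on the interval ]a, b[, the form
   [((T - a) f, (T - b) f)] is nonnegative.  Applied to [(H - l)^2] this also
   shows that [H - l] is invertible on the orthogonal complement of the
   eigenspace of the isolated point [l]. *)
Require Import Defs.
From HB Require Import structures.
From mathcomp Require Import all_boot all_order all_algebra.
From mathcomp Require Import sesquilinear complex.
From mathcomp Require Import all_classical all_reals all_analysis.
From mathcomp Require Import ring lra.
Set Implicit Arguments.
Unset Strict Implicit.
Unset Printing Implicit Defensive.
Import Order.TTheory GRing.Theory Num.Theory.
Import numFieldNormedType.Exports.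
Local Open Scope classical_set_scope.
Local Open Scope ring_scope.
Local Open Scope complex_scope.

(** * Real part of the inner product *)

Section RealInnerProduct.
Variables (R : realType) (E : hilbertSpace R).
Implicit Types (x y z : E) (a b : R).

(** The real inner product underlying [hdot]. The spectral parameters are real, so most of the
    argument runs over [R], within reach of [ring] and [lra]. *)
Definition rdot x y : R := complex.Re '[x, y].

Lemma rdotDl x y z : rdot (x + y) z = rdot x z + rdot y z.
Proof. by rewrite /rdot linearDl raddfD. Qed.

Lemma rdotNl x y : rdot (- x) y = - rdot x y.
Proof. by rewrite /rdot linearNl raddfN. Qed.

Lemma rdotBl x y z : rdot (x - y) z = rdot x z - rdot y z.
Proof. by rewrite rdotDl rdotNl. Qed.

Lemma rdotZl a x y : rdot (a%:C *: x) y = a * rdot x y.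
Proof. by rewrite /rdot linearZl_LR /=; case: '[x, y] => p q /=; rewrite mul0r subr0. Qed.

Lemma hdotC x y : '[y, x] = ('[x, y])^*.
Proof. by rewrite hermC expr0 mul1r. Qed.

Lemma rdotC x y : rdot x y = rdot y x.
Proof. by rewrite /rdot (hdotC x y); case: '[x, y]. Qed.

Lemma rdotDr x y z : rdot x (y + z) = rdot x y + rdot x z.
Proof. by rewrite rdotC rdotDl !(rdotC x). Qed.

Lemma rdotNr x y : rdot x (- y) = - rdot x y.
Proof. by rewrite rdotC rdotNl rdotC. Qed.

Lemma rdotBr x y z : rdot x (y - z) = rdot x y - rdot x z.
Proof. by rewrite rdotDr rdotNr. Qed.

Lemma rdotZr a x y : rdot x (a%:C *: y) = a * rdot x y.
Proof. by rewrite rdotC rdotZl rdotC. Qed.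

Lemma rdot0l x : rdot 0 x = 0.
Proof. by rewrite -(subrr x) rdotBl subrr. Qed.

Lemma rdot0r x : rdot x 0 = 0.
Proof. by rewrite rdotC rdot0l. Qed.

Definition rdotE := (rdotDl, rdotDr, rdotNl, rdotNr, rdotZl, rdotZr).

Lemma normE x : `|x| = (nrm x)%:C.
Proof. by rewrite /nrm RRe_real // normr_real. Qed.

Lemma nrm_ge0 x : 0 <= nrm x.
Proof. by rewrite -lecR -normE normr_ge0. Qed.

Lemma hdotxx x : '[x, x] = (nrm x ^+ 2)%:C.
Proof. by rewrite hdotE normE -rmorphXn. Qed.

Lemma rdotxx x : rdot x x = nrm x ^+ 2.
Proof. by rewrite /rdot hdotxx. Qed.

Lemma nrm_eq0 x : (nrm x == 0) = (x == 0).
Proof. by rewrite -(normr_eq0 x) normE (inj_eq (@complexI _)). Qed.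

Lemma nrm0 : nrm (0 : E) = 0.
Proof. by apply/eqP; rewrite nrm_eq0. Qed.

Lemma nrmZ (a : R[i]) x : nrm (a *: x) = complex.Re `|a| * nrm x.
Proof.
by apply: complexI; rewrite -normE normrZ normE rmorphM/= RRe_real// normr_real.
Qed.

Lemma nrmZr a x : nrm (a%:C *: x) = `|a| * nrm x.
Proof. by rewrite nrmZ normc_def /= expr0n/= addr0 sqrtr_sqr. Qed.

Lemma nrmN x : nrm (- x) = nrm x.
Proof. by apply: complexI; rewrite -!normE normrN. Qed.

Lemma nrmD x y : nrm (x + y) <= nrm x + nrm y.
Proof. by have := ler_normD x y; rewrite !normE -rmorphD lecR. Qed.

Lemma nrmB x y : nrm (x - y) <= nrm x + nrm y.
Proof. by rewrite -(nrmN y) nrmD. Qed.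

Lemma nrm_leB x y : nrm x - nrm y <= nrm (x - y).
Proof. by have := nrmD (x - y) y; rewrite subrK lerBlDr. Qed.

(** Serves to prove vector identities: paired with an arbitrary [w] they become scalar ones, settled
    by [rdotE] and [ring]. *)
Lemma rdot_inj x y : (forall w, rdot x w = rdot y w) -> x = y.
Proof.
move=> xy; apply/eqP; rewrite -subr_eq0 -nrm_eq0 -sqrf_eq0 -rdotxx.
by rewrite rdotBl xy subrr.
Qed.

Lemma rdot_ge0 x : 0 <= rdot x x.
Proof. by rewrite rdotxx sqr_ge0. Qed.

Lemma ler_nrm_scale a x y : 0 <= a ->
  (a * nrm x <= nrm y) = (a ^+ 2 * rdot x x <= rdot y y).
Proof.
move=> a0; rewrite !rdotxx -exprMn ler_sqr// nnegrE ?nrm_ge0//.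
by apply: mulr_ge0 => //; exact: nrm_ge0.
Qed.

End RealInnerProduct.

Lemma discriminant_le (R : realFieldType) (A B C : R) :
  (forall t, 0 <= A + 2 * t * B + t ^+ 2 * C) -> B ^+ 2 <= A * C.
Proof.
move=> P; have A0 : 0 <= A by have := P 0; rewrite expr0n/= mulr0 !mul0r !addr0.
have [C0|C0|C0] := ltgtP C 0.
(* In the sum of the values at [t] and [- t] the linear terms cancel, while [t >= 1] and
   [(t - 1) * C = - (A + 1)] make [A + t ^+ 2 * C] negative. *)
- have := P (1 + (A + 1) / - C); have := P (- (1 + (A + 1) / - C)).
  set t := 1 + _; have tC : (t - 1) * C = - (A + 1) by rewrite /t; field; lra.
  have t1 : 0 <= t - 1 by rewrite /t addrAC subrr add0r divr_ge0; lra.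
  by nra.
- have := P (- B / C); set t := _ / _.
  have tC : t * C = - B by rewrite /t; field; lra.
  have -> : t ^+ 2 * C = - (t * B) by rewrite expr2 -mulrA tC mulrN.
  move=> H; have : 0 <= (A + t * B) * C by apply: mulr_ge0; [lra|exact: ltW].
  by rewrite mulrDl mulrAC tC; lra.
- rewrite C0 in P *; rewrite mulr0; have [->|B0] := eqVneq B 0; first by rewrite expr0n.
  (* This [t] gives [A + 2 * t * B = - A - 2 < 0]. *)
  have := P (- (1 + A) / B); set t := _ / _.
  have tB : t * B = - (1 + A) by rewrite /t; field.
  by rewrite mulr0 addr0; lra.
Qed.

Section CauchySchwarz.
Variables (R : realType) (E : hilbertSpace R).
Implicit Types (x y z : E).

Lemma rdot_sqr_le x y : rdot x y ^+ 2 <= (nrm x * nrm y) ^+ 2.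
Proof.
rewrite exprMn -!rdotxx; apply: discriminant_le => t.
suff -> : rdot x x + 2 * t * rdot x y + t ^+ 2 * rdot y y =
  rdot (x + t%:C *: y) (x + t%:C *: y) by exact: rdot_ge0.
by rewrite !rdotE (rdotC y x); ring.
Qed.

Lemma rdot_abs_le x y : `|rdot x y| <= nrm x * nrm y.
Proof.
rewrite -ler_sqr ?nnegrE ?mulr_ge0 ?nrm_ge0//.
by rewrite real_normK ?num_real// rdot_sqr_le.
Qed.

Lemma rdot_le x y : rdot x y <= nrm x * nrm y.
Proof. exact: le_trans (ler_norm _) (rdot_abs_le x y). Qed.

End CauchySchwarz.

(** * Spectral gaps *)

Section SpectralGap.
Variables (R : realType) (E : hilbertSpace R).
Implicit Types (D : set E) (T : E -> E) (x y f g : E) (a b z : R).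

Definition real_linear_on D T := D 0 /\ forall a x y, D x -> D y ->
  D (a%:C *: x + y) /\ T (a%:C *: x + y) = a%:C *: T x + T y.

Definition symmetric_on D T := forall x y, D x -> D y ->
  rdot (T x) y = rdot x (T y).

Definition coercive_on D T z := exists2 d : R, 0 < d &
  forall f, D f -> d * nrm f <= nrm (T f - z%:C *: f).

(** Right-hand sides are taken in [D] because [D] will also be cut down to the orthogonal complement
    of an eigenspace, where [T - z] need not reach the whole space. *)
Definition solvable_on D T z := forall f, D f ->
  exists2 g, D g & T g - z%:C *: g = f.

Lemma real_linear_onD D T x y : real_linear_on D T -> D x -> D y ->
  D (x + y) /\ T (x + y) = T x + T y.
Proof. by move=> [_ L] Dx Dy; have := L 1 x y Dx Dy; rewrite !scale1r. Qed.

Lemma real_linear_on0 D T : real_linear_on D T -> T 0 = 0.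
Proof.
move=> L; have [_] := real_linear_onD L L.1 L.1.
by rewrite addr0 => /eqP; rewrite -subr_eq0 opprD addNKr oppr_eq0 => /eqP.
Qed.

Lemma real_linear_onZ D T a x : real_linear_on D T -> D x ->
  D (a%:C *: x) /\ T (a%:C *: x) = a%:C *: T x.
Proof.
move=> L Dx; have [] := L.2 a x 0 Dx L.1.
by rewrite (real_linear_on0 L) !addr0.
Qed.

Lemma real_linear_onB D T x y : real_linear_on D T -> D x -> D y ->
  D (x - y) /\ T (x - y) = T x - T y.
Proof.
move=> L Dx Dy; have := L.2 (-1) y x Dy Dx.
by rewrite rmorphN rmorph1 !scaleN1r ![- _ + _]addrC.
Qed.

Lemma real_scaleBl a b x : (a - b)%:C *: x = a%:C *: x - b%:C *: x.
Proof. by rewrite rmorphB scalerBl. Qed.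

(* If the best constant [r] in [r |f| <= |(T - c) f|], [c] the midpoint, were
   smaller than half the length of the gap, then the form
   [q f = |(T - c) f|^2 - r^2 |f|^2] would be nonnegative; as [T - c + r] and
   [T - c - r] are invertible, Cauchy-Schwarz for [q] bounds it from below by a
   multiple of [|f|^2], so that [r] could be enlarged. *)
Section Gap.
Variables (D : set E) (T : E -> E) (a b : R).
Hypothesis T_lin : real_linear_on D T.
Hypothesis T_sym : symmetric_on D T.
Hypothesis T_coer : forall z, a < z < b -> coercive_on D T z.
Hypothesis T_solv : forall z, a < z < b -> solvable_on D T z.

Let c := (a + b) / 2.
Let K f := T f - c%:C *: f.

Lemma gap_enlarge r : 0 <= r < (b - a) / 2 ->
  (forall f, D f -> r * nrm f <= nrm (K f)) ->
  exists2 r', r < r' & forall f, D f -> r' * nrm f <= nrm (K f).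
Proof.
move=> /andP[r0 rlt] Kr.
have Ksym f g : D f -> D g -> rdot (K f) g = rdot f (K g).
  by move=> Df Dg; rewrite !rdotE T_sym// !rdotE.
pose q f g := rdot (K f) (K g) - r ^+ 2 * rdot f g.
have q_ge0 f : D f -> 0 <= q f f.
  move=> Df; rewrite /q subr_ge0 !rdotxx -exprMn ler_sqr ?nnegrE ?nrm_ge0 ?Kr//.
  by rewrite mulr_ge0// nrm_ge0.
have q_CS f g : D f -> D g -> q f g ^+ 2 <= q f f * q g g.
  move=> Df Dg; apply: discriminant_le => t.
  have [Dtg Ttg] := T_lin.2 t g f Dg Df; have := q_ge0 _ Dtg.
  congr (_ <= _); rewrite /q /K Ttg !rdotE.
  by rewrite (rdotC (T g) (T f)) (rdotC g f) (rdotC g (T f)) (rdotC (T g) f); ring.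
have zp : a < c + r < b by rewrite /c; lra.
have zm : a < c - r < b by rewrite /c; lra.
have [dp dp0 Cp] := T_coer zp; have [dm dm0 Cm] := T_coer zm.
pose C := 1 + r / dm.
have C0 : 0 < C by rewrite ltr_wpDr// divr_ge0// ltW.
have bnd f : D f -> (dp / C * nrm f) ^+ 2 <= q f f.
  move=> Df; pose N := nrm (T f - (c + r)%:C *: f).
  (* Here [(K + r) g = (K - r) f]. Solving for [g - f] instead keeps the right-hand side, [- 2 * r]
     times [f], inside [D]. *)
  have [g Dg gE] : exists2 g, D g & T g - (c - r)%:C *: g = T f - (c + r)%:C *: f.
    have [g' Dg' g'E] := T_solv zm (real_linear_onZ (- 2 * r) T_lin Df).1.
    have [Dg Tg] := real_linear_onD T_lin Df Dg'; exists (f + g') => //.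
    apply: rdot_inj => w; have /(congr1 (fun x => rdot x w)) := g'E.
    by rewrite Tg !rdotE; lra.
  have Kg_le : nrm (K g) <= C * N.
    have gN : nrm g <= N / dm.
      by rewrite ler_pdivlMr// mulrC /N -gE Cm.
    have -> : K g = (T g - (c - r)%:C *: g) - r%:C *: g.
      by apply: rdot_inj => w; rewrite !rdotE; ring.
    rewrite (le_trans (nrmB _ _))// gE nrmZr ger0_norm// mulrDl mul1r lerD2l.
    by rewrite mulrAC -mulrA ler_wpM2l.
  have N0 : 0 <= N := nrm_ge0 _.
  (* By symmetry [q f g = ((K - r) f, (K + r) g)], and both factors are the same vector of norm
     [N]. *)
  have NE : N ^+ 2 = q f g.
    rewrite -rdotxx -[in X in rdot _ X]gE /q /K !rdotE.
    by rewrite (T_sym Df Dg); ring.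
  have qg : q g g <= (C * N) ^+ 2.
    have : rdot (K g) (K g) <= (C * N) ^+ 2.
      by rewrite rdotxx ler_sqr ?nnegrE ?nrm_ge0// mulr_ge0 ?(ltW C0).
    by apply: le_trans; rewrite /q gerBl mulr_ge0 ?sqr_ge0 ?rdot_ge0.
  have NC : N ^+ 2 <= C ^+ 2 * q f f.
    have [N1|N1] := eqVneq N 0.
      by rewrite N1 expr0n/= mulr_ge0 ?sqr_ge0 ?q_ge0.
    have := q_CS f g Df Dg; rewrite -NE => /le_trans/(_ (ler_wpM2l (q_ge0 f Df) qg)).
    have N2 : 0 < N ^+ 2 by rewrite exprn_gt0// lt_def N1.
    move=> H; rewrite -(ler_pM2r N2) -expr2 (le_trans H)// exprMn.
    by rewrite le_eqVlt; apply/orP; left; apply/eqP; ring.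
  have -> : (dp / C * nrm f) ^+ 2 = (dp * nrm f) ^+ 2 / C ^+ 2.
    by field; rewrite gt_eqF.
  rewrite ler_pdivrMr ?exprn_gt0// [leRHS]mulrC.
  rewrite (le_trans _ NC)// ler_sqr ?nnegrE ?mulr_ge0 ?nrm_ge0 ?(ltW dp0)//.
  exact: Cp.
have : 0 < dp / C by rewrite divr_gt0.
move: (dp / C) bnd => k bnd k0.
exists (Num.sqrt (r ^+ 2 + k ^+ 2)).
  rewrite -[X in X < _](ger0_norm r0) -sqrtr_sqr ltr_sqrt.
    by rewrite ltrDl exprn_gt0.
  by rewrite ltr_wpDl ?sqr_ge0// exprn_gt0.
move=> f Df; rewrite -ler_sqr ?nnegrE ?mulr_ge0 ?sqrtr_ge0 ?nrm_ge0//.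
have := bnd f Df; rewrite /q !rdotxx !exprMn sqr_sqrtr ?addr_ge0 ?sqr_ge0//.
by rewrite mulrDl; lra.
Qed.

Lemma gap_form_ge0 f : a < b -> D f ->
  0 <= rdot (T f - a%:C *: f) (T f - b%:C *: f).
Proof.
move=> ab Df.
pose rho := (b - a) / 2.
(* With [c] the midpoint, [((T - a) f, (T - b) f) = |K f|^2 - rho^2 |f|^2]. *)
suff H : rho * nrm f <= nrm (K f).
  have rho0 : 0 <= rho by rewrite /rho; lra.
  by move: H; rewrite ler_nrm_scale// /K !rdotE (rdotC f (T f)) /rho /c; lra.
(* A failing [f0] keeps every admissible constant below [rho]. Their supremum is itself admissible,
   and [gap_enlarge] then exceeds it. *)
have [[f0 [Df0 f0E]]|noex] := pselect (exists f0, D f0 /\ nrm (K f0) < rho * nrm f0);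
  last by rewrite leNgt; apply/negP => ?; apply: noex; exists f.
pose S := [set r | 0 <= r /\ forall f, D f -> r * nrm f <= nrm (K f)].
have S0 : S 0 by split=> // g Dg; rewrite mul0r nrm_ge0.
have Slt r : S r -> r < rho.
  move=> [_ /(_ _ Df0)] /le_lt_trans/(_ f0E); apply: contraTT.
  by rewrite -!leNgt => rr; rewrite ler_wpM2r// nrm_ge0.
have Ssup : has_sup S by split; [exists 0|exists rho => r /Slt /ltW].
have supS : S (sup S).
  split; first by apply: ub_le_sup S0; exact: Ssup.2.
  move=> g Dg; have [->|g0] := eqVneq (nrm g) 0; first by rewrite mulr0 nrm_ge0.
  have {}g0 : 0 < nrm g by rewrite lt_def g0 nrm_ge0.
  rewrite -ler_pdivlMr//; apply: ge_sup; first by exists 0.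
  by move=> r [_ /(_ _ Dg)]; rewrite ler_pdivlMr.
have supSlt : 0 <= sup S < rho by rewrite supS.1 Slt.
have [r' r'lt r'P] := gap_enlarge supSlt supS.2.
suff : r' <= sup S by rewrite leNgt r'lt.
apply: ub_le_sup; first exact: Ssup.2.
by split=> //; rewrite (le_trans supS.1)// ltW.
Qed.

End Gap.
End SpectralGap.

(** * Isolated points of the spectrum *)

Section Limits.
Variables (R : realType) (E : hilbertSpace R).

(** The sequences below converge at the explicit rate [1 / (k + 1)], so that passing to the limit is
    this Archimedean fact. *)
Lemma le0_harmonic (a c : R) : (forall k, a <= c * k.+1%:R^-1) -> a <= 0.
Proof.
move=> ac; rewrite leNgt; apply/negP => a0.
have c0 : 0 < c by have := ac 0%N; rewrite invr1 mulr1; exact: lt_le_trans.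
have := ac (Num.truncn (c / a)); rewrite leNgt => /negP; apply.
rewrite ltr_pdivrMr ?ltr0Sn// mulrC -ltr_pdivrMr//.
by rewrite truncnS_gt// divr_ge0 // ltW.
Qed.

Lemma harmonic_cauchy (x_ : nat -> E) (C : R) :
  (forall m n, nrm (x_ m - x_ n) <= C * (m.+1%:R^-1 + n.+1%:R^-1)) ->
  exists x, forall k, nrm (x_ k - x) <= C * k.+1%:R^-1.
Proof.
move=> xC; have C0 : 0 <= C.
  by have := xC 0%N 0%N; rewrite subrr nrm0 pmulr_lge0// invr1; lra.
have small (e : R) : 0 < e -> \forall k \near \oo, C * k.+1%:R^-1 < e.
  move=> e0; near=> k; rewrite ltr_pdivrMr ?ltr0Sn// mulrC -ltr_pdivrMr//.
  rewrite (@lt_trans _ _ k%:R) ?ltr_nat//; near: k; exact: nbhs_infty_gtr.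
have /cauchy_cvgP/cvg_ex[x /= x_x] : cauchy (x_ @ \oo).
  apply/cauchy_ballP => e e0; have [e' e'0 ->] : exists2 e' : R, 0 < e' & e = e'%:C.
    exists (complex.Re e); first by move: e0; rewrite ltcE => /andP[].
    by rewrite RRe_real// gtr0_real.
  have e2 : 0 < e' / 2 by lra.
  rewrite near_map2; near=> m n.
  rewrite -ball_normE /= normE ltcR (le_lt_trans (xC m n))// mulrDr.
  have -> : e' = e' / 2 + e' / 2 by lra.
  by rewrite ltrD//; [near: m|near: n]; exact: small.
exists x => k; rewrite -subr_le0; apply: (@le0_harmonic _ 2) => n.
have n0 : 0 < n.+1%:R^-1 :> R by rewrite invr_gt0 ltr0Sn.
have : \forall m \near \oo, nrm (x_ m - x) < n.+1%:R^-1.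
  near=> m; rewrite -ltcR -normE distrC; near: m.
  by move/cvgrPdist_lt : x_x; apply; rewrite ltcR.
move=> /(filterI (small _ n0))/filter_ex[m [Cm xm]].
have := nrmD (x_ k - x_ m) (x_ m - x); rewrite addrA subrK.
have := xC k m; move: Cm xm n0; rewrite mulrDr.
by move: (C / k.+1%:R) (C / m.+1%:R) n.+1%:R^-1 => p q w; lra.
Unshelve. all: by end_near. Qed.

End Limits.

Section IsolatedPoint.
Variables (R : realType) (E : hilbertSpace R).
Variables (D : set E) (K : E -> E) (e : R).
Implicit Types (f g x y : E) (t z : R).

(** Closedness of the graph, along sequences with the rate that [harmonic_cauchy] delivers. *)
Definition closed_op (D : set E) (T : E -> E) := forall (x_ : nat -> E) (C : R) x y,
  (forall k, D (x_ k)) ->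
  (forall k, nrm (x_ k - x) <= C * k.+1%:R^-1) ->
  (forall k, nrm (T (x_ k) - y) <= C * k.+1%:R^-1) ->
  D x /\ T x = y.

(** For a complex subspace [N] this is full orthogonality, since [N] contains [i x] along with
    [x]. *)
Definition rortho (N : set E) : set E := [set g | forall x, N x -> rdot g x = 0].

Hypothesis e0 : 0 < e.
Hypothesis K_lin : real_linear_on D K.
Hypothesis K_sym : symmetric_on D K.
Hypothesis K_closed : closed_op D K.
Hypothesis K_coer : forall z, 0 < `|z| < e -> coercive_on D K z.
Hypothesis K_onto : forall z, 0 < `|z| < e ->
  forall f, exists2 g, D g & K g - z%:C *: g = f.

Let N : set E := [set x | D x /\ K x = 0].

(* [K^2] has the spectral gap ]0, e^2[. *)
Lemma isolated_coercive_range f : D f -> D (K f) ->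
  e * nrm (K f) <= nrm (K (K f)).
Proof.
move=> Df DKf; pose D2 : set E := [set x | D x /\ D (K x)].
have D2_lin : real_linear_on D2 (K \o K).
  split=> [|a x y [Dx DKx] [Dy DKy]].
    by split; rewrite ?(real_linear_on0 K_lin); exact: K_lin.1.
  have [D1 K1] := K_lin.2 a x y Dx Dy; have [D3 K3] := K_lin.2 a _ _ DKx DKy.
  by split; [split|]; rewrite /= ?K1.
have D2_sym : symmetric_on D2 (K \o K).
  by move=> x y [Dx DKx] [Dy DKy]; rewrite /= !K_sym.
have sqrtz z : 0 < z < e ^+ 2 -> exists w, [/\ z = w ^+ 2, 0 < `|w| < e & 0 < `|- w| < e].
  move=> /andP[z0 ze]; exists (Num.sqrt z); rewrite sqr_sqrtr ?ltW// normrN.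
  have : 0 < `|Num.sqrt z| < e; last by split.
  rewrite normr_gt0 gt_eqF ?sqrtr_gt0//= ger0_norm ?sqrtr_ge0//.
  by rewrite -[e]ger0_norm ?ltW// -sqrtr_sqr ltr_sqrt// exprn_gt0.
(* The factorization [K^2 - w^2 = (K - w)(K + w)] transfers coercivity and solvability from [K] to
   [K^2]. *)
have fact w x : D2 x -> K (K x) - (w ^+ 2)%:C *: x =
    K (K x - (- w)%:C *: x) - w%:C *: (K x - (- w)%:C *: x).
  move=> [Dx DKx]; have [Dwx Kwx] := real_linear_onZ (- w) K_lin Dx.
  rewrite (real_linear_onB K_lin DKx Dwx).2 Kwx.
  by apply: rdot_inj => v; rewrite !rdotE; ring.
have D2_coer z : 0 < z < e ^+ 2 -> coercive_on D2 (K \o K) z.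
  move=> /sqrtz[w [-> w1 w2]]; have [d1 d10 Kd1] := K_coer w1.
  have [d2 d20 Kd2] := K_coer w2; exists (d1 * d2); first exact: mulr_gt0.
  move=> x D2x /=; rewrite fact//; have [Dx DKx] := D2x.
  have Dwx := (real_linear_onZ (- w) K_lin Dx).1.
  apply: le_trans (Kd1 _ (real_linear_onB K_lin DKx Dwx).1).
  by rewrite -mulrA ler_wpM2l ?(ltW d10)// Kd2.
have D2_solv z : 0 < z < e ^+ 2 -> solvable_on D2 (K \o K) z.
  move=> /sqrtz[w [-> w1 w2]] x _; have [y Dy yE] := K_onto w1 x.
  have [g Dg gE] := K_onto w2 y.
  have KgE : K g = y + (- w)%:C *: g by rewrite -gE subrK.
  have DKg : D (K g).
    by rewrite KgE; exact: (real_linear_onD K_lin Dy (real_linear_onZ _ K_lin Dg).1).1.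
  by exists g; [split|rewrite /= fact// gE].
(* For the endpoints [0] and [e ^+ 2] the form reads [|K^2 f|^2 - e^2 (K^2 f, f)], and
   [(K^2 f, f) = |K f|^2]. *)
have := gap_form_ge0 D2_lin D2_sym D2_coer D2_solv (exprn_gt0 2 e0) (conj Df DKf).
rewrite rmorph0 scale0r subr0 rdotBr rdotZr subr_ge0 ler_nrm_scale ?(ltW e0)//.
by rewrite (K_sym DKf Df).
Qed.

(** Solves [K f = y] by regularization: [(K - t_k) f_k = y] with [t_k] tending to 0. The differences
    satisfy [K (f_m - f_n) = t_m f_m - t_n f_n], so coercivity on them makes the bounded sequence
    [f_] Cauchy, and closedness identifies the limit. *)
Lemma isolated_limit (f_ : nat -> E) (M : R) y :
  let t k := e / 2 * k.+1%:R^-1 in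
  (forall k, D (f_ k)) -> (forall k, nrm (f_ k) <= M) ->
  (forall k, K (f_ k) = y + (t k)%:C *: f_ k) ->
  (forall m n, e * nrm (f_ m - f_ n) <= nrm (K (f_ m - f_ n))) ->
  exists f, [/\ D f, K f = y & forall k, nrm (f_ k - f) <= M / 2 * k.+1%:R^-1].
Proof.
move=> t Df fM Kf ef; have M0 : 0 <= M := le_trans (nrm_ge0 _) (fM 0%N).
have t0 k : 0 <= t k by rewrite mulr_ge0 ?invr_ge0// divr_ge0// ltW.
have tf k : nrm ((t k)%:C *: f_ k) <= e * (M / 2) * k.+1%:R^-1.
  rewrite nrmZr ger0_norm// (@le_trans _ _ (t k * M))//.
    by rewrite ler_wpM2l.
  by rewrite /t le_eqVlt; apply/orP; left; apply/eqP; ring.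
have [m n|f fE] := @harmonic_cauchy R E f_ (M / 2).
  rewrite -(ler_pM2l e0) (le_trans (ef m n))//.
  rewrite (real_linear_onB K_lin (Df m) (Df n)).2 !Kf opprD addrACA subrr add0r.
  by rewrite (le_trans (nrmB _ _))// mulrA mulrDr lerD.
exists f; suff [] : D f /\ K f = y by [].
apply: (K_closed (x_ := f_) (C := M / 2 + e * (M / 2))) => // k.
  by rewrite mulrDl (le_trans (fE k))// lerDl !mulr_ge0// ltW.
rewrite Kf addrAC subrr add0r (le_trans (tf k))// [leRHS]mulrDl lerDr.
by rewrite !mulr_ge0.
Qed.

Lemma rortho_range f : D f -> rortho N (K f).
Proof. by move=> Df x [Dx Kx]; rewrite K_sym// Kx rdot0r. Qed.

Lemma rortho_limit (f_ : nat -> E) (C : R) f : (forall k, rortho N (f_ k)) ->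
  (forall k, nrm (f_ k - f) <= C * k.+1%:R^-1) -> rortho N f.
Proof.
move=> fN fC x Nx; apply/eqP; rewrite -normr_le0.
apply: (le0_harmonic (c := (C * nrm x))) => k.
have -> : rdot f x = - rdot (f_ k - f) x by rewrite rdotBl (fN k x Nx) sub0r opprK.
rewrite normrN (le_trans (rdot_abs_le _ _))// mulrAC ler_wpM2r ?nrm_ge0//.
Qed.

Let t k : R := e / 2 * k.+1%:R^-1.

Lemma harmonic_step_bounds k : 0 < t k <= e / 2.
Proof.
rewrite /t mulr_gt0 ?invr_gt0 ?ltr0Sn ?divr_gt0//=.
apply: ler_piMr; first by apply/ltW/divr_gt0.
by rewrite invf_le1 ?ltr0Sn// ler1n.
Qed.

Lemma harmonic_step_small k : 0 < `|t k| < e.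
Proof. by have /andP[t0 te] := harmonic_step_bounds k; rewrite gtr0_norm// t0; lra. Qed.

(* [e |f_k| <= |K f_k| <= |y| + (e / 2) |f_k|] *)
Lemma isolated_bound f y k : e * nrm f <= nrm (K f) -> K f = y + (t k)%:C *: f ->
  nrm f <= 2 / e * nrm y.
Proof.
move=> ef Kf; have /andP[t0 te] := harmonic_step_bounds k.
have : nrm (K f) <= nrm y + t k * nrm f.
  by rewrite Kf (le_trans (nrmD _ _))// nrmZr gtr0_norm.
have := ler_wpM2r (nrm_ge0 f) te => H1 H2.
by rewrite mulrAC ler_pdivlMr// mulrC; lra.
Qed.

(** The estimate known on the range of [K] is carried to [g] by [g_k = K h_k], where
    [(K - t_k) h_k = g]. These converge to some [g'] with [K g' = K g]; then [g - g'] lies both in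
    [N] and in its complement, so [g' = g]. *)
Lemma isolated_coercive g : D g -> rortho N g -> e * nrm g <= nrm (K g).
Proof.
move=> Dg gN; have /choice[h_ hP] : forall k, exists h, D h /\ K h - (t k)%:C *: h = g.
  by move=> k; have [h] := K_onto (harmonic_step_small k) g; exists h.
have Dh k : D (h_ k) := (hP k).1.
pose g_ k := K (h_ k).
have gE k : g_ k = g + (t k)%:C *: h_ k by rewrite /g_ -(hP k).2 subrK.
have Dt k : D ((t k)%:C *: h_ k) := (real_linear_onZ _ K_lin (Dh k)).1.
have D_g k : D (g_ k) by rewrite gE; exact: (real_linear_onD K_lin Dg (Dt k)).1.
have Kg k : K (g_ k) = K g + (t k)%:C *: g_ k.
  rewrite {1}gE (real_linear_onD K_lin Dg (Dt k)).2.
  by rewrite (real_linear_onZ _ K_lin (Dh k)).2.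
have eg k : e * nrm (g_ k) <= nrm (K (g_ k)).
  exact: isolated_coercive_range (Dh k) (D_g k).
have [|m n|g' [Dg' Kg' gg']] := isolated_limit (M := 2 / e * nrm (K g)) D_g _ Kg.
- by move=> k; exact: isolated_bound (eg k) (Kg k).
- have [Dmn Kmn] := real_linear_onB K_lin (Dh m) (Dh n).
  rewrite /g_ -Kmn; apply: isolated_coercive_range => //.
  by rewrite Kmn; exact: (real_linear_onB K_lin (D_g m) (D_g n)).1.
have g'N : rortho N g' by apply: rortho_limit gg' => k; exact: rortho_range.
have [Dd Kd] := real_linear_onB K_lin Dg Dg'.
have /eqP : rdot (g - g') (g - g') = 0.
  have Nd : N (g - g') by split=> //; rewrite Kd Kg' subrr.
  by rewrite rdotBl (gN _ Nd) (g'N _ Nd) subrr.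
rewrite rdotxx sqrf_eq0 nrm_eq0 subr_eq0 => /eqP gg.
rewrite -{}gg in gg' *; set M := 2 / e * _ in gg'.
(* The limit of [e |g_k| <= |K g_k|]: the constant collects the errors [e |g - g_k|] and
   [t_k |g_k|]. *)
rewrite -subr_le0; apply: (le0_harmonic (c := (e * (M / 2) + e / 2 * M))) => k.
have := nrm_leB g (g - g_ k); rewrite subKr -(nrmN (g - _)) opprB => H1.
have H2 := ler_wpM2l (ltW e0) (gg' k).
have := nrmD (K g) ((t k)%:C *: g_ k); rewrite -Kg nrmZr.
have /andP[t0 _] := harmonic_step_bounds k; rewrite gtr0_norm// => H3.
have := ler_wpM2l (ltW t0) (isolated_bound (eg k) (Kg k)); rewrite -/M => H4.
have := ler_wpM2l (ltW e0) H1; have := eg k; rewrite mulrDl.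
rewrite /t in H3 H4; move: H2 H3 H4.
by move: k.+1%:R^-1 (nrm (g_ k)) (nrm (g_ k - g)) => w p q; lra.
Qed.

(** The regularized solutions stay orthogonal to [N], because pairing their equation with [x] in [N]
    leaves [- t_k (f_k, x) = 0]; hence [isolated_coercive] applies to them. *)
Lemma isolated_onto y : rortho N y -> exists f, [/\ D f, rortho N f & K f = y].
Proof.
move=> yN; have /choice[f_ fP] : forall k, exists h, D h /\ K h - (t k)%:C *: h = y.
  by move=> k; have [h] := K_onto (harmonic_step_small k) y; exists h.
have Df k : D (f_ k) := (fP k).1.
have Kf k : K (f_ k) = y + (t k)%:C *: f_ k by rewrite -(fP k).2 subrK.
have fN k : rortho N (f_ k).
  move=> x Nx; have := yN x Nx; rewrite -(fP k).2 rdotBl (rortho_range (Df k) Nx).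
  rewrite sub0r rdotZl => /eqP; rewrite oppr_eq0 mulf_eq0.
  by have /andP[t0 _] := harmonic_step_bounds k; rewrite gt_eqF//= => /eqP.
have ef k : e * nrm (f_ k) <= nrm (K (f_ k)) by exact: isolated_coercive.
have [k|m n|f [Df' Kf' ff']] := isolated_limit (M := 2 / e * nrm y) Df _ Kf.
- exact: isolated_bound (ef k) (Kf k).
- apply: isolated_coercive; first exact: (real_linear_onB K_lin (Df m) (Df n)).1.
  by move=> x Nx; rewrite rdotBl !fN// subrr.
by exists f; split=> //; exact: rortho_limit fN ff'.
Qed.

End IsolatedPoint.

(** * Selfadjoint operators and the removal of an isolated eigenvalue *)

Section SelfadjointOperators.
Variables (R : realType) (E : hilbertSpace R).
Implicit Types (A : operator E) (f g x y : E) (z : R).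

Lemma rdot_hdot_eq x y x' y' :
  (forall a : R[i], rdot (a *: x) y = rdot (a *: x') y') -> '[x, y] = '[x', y'].
Proof.
move=> H; have := H 1; have := H 'i; rewrite !scale1r /rdot !linearZl_LR /=.
case: '[x, y] => p q; case: '[x', y'] => p' q' /=.
by rewrite !mul0r !mul1r !sub0r => /oppr_inj -> ->.
Qed.

Lemma linear_bounded (B : {linear E -> E}) : continuous (B : E -> E) ->
  exists2 M : R, 0 < M & forall x, nrm (B x) <= M * nrm x.
Proof.
move=> /linear_bounded_continuous/linear_boundedP/filter_ex[r rP].
exists (`|complex.Re r| + 1) => [|x]; first by rewrite ltr_wpDl.
have := rP x; rewrite !normE lecE => /andP[_ /=].
case: r {rP} => p q /=; rewrite mulr0 subr0 => /le_trans; apply.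
by rewrite ler_wpM2r ?nrm_ge0// (le_trans (ler_norm p))// lerDl.
Qed.

Lemma selfadjoint_real_linear A : selfadjoint A -> real_linear_on (odom A) A.
Proof.
move=> [[[D0 DL] AL] _ _]; split=> // a x y Dx Dy.
by split; [exact: DL|exact: AL].
Qed.

Lemma selfadjoint_hdot A x y : selfadjoint A -> odom A x -> odom A y ->
  '[A x, y] = '[x, A y].
Proof. by move=> [_ _ AP] Dx Dy; have [_] := AP y (A y); apply. Qed.

Lemma selfadjoint_sym A : selfadjoint A -> symmetric_on (odom A) A.
Proof. by move=> sA x y Dx Dy; rewrite /rdot selfadjoint_hdot. Qed.

(** Real parts suffice in the adjoint relation: the domain is a complex subspace, and multiplying
    [x] by 1 and by [i] recovers the complex inner product. *)
Lemma selfadjointP A y w : selfadjoint A ->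
  (forall x, odom A x -> rdot (A x) y = rdot x w) -> odom A y /\ A y = w.
Proof.
move=> sA H; have A0 := real_linear_on0 (selfadjoint_real_linear sA).
have [[[D0 DL] AL] _ AP] := sA.
apply/AP => x Dx; apply: rdot_hdot_eq => a.
have := DL a x 0 Dx D0; have := AL a x 0 Dx D0; rewrite A0 !addr0 => <- Dax.
exact: H.
Qed.

Lemma selfadjoint_closed A : selfadjoint A -> closed_op (odom A) A.
Proof.
move=> sA x_ C x y Dx xC yC; apply: selfadjointP => // w Dw.
suff : `|rdot (A w) x - rdot w y| <= 0.
  by rewrite normr_le0 subr_eq0 => /eqP.
apply: (@le0_harmonic _ _ (nrm w * C + nrm (A w) * C)) => k.
have -> : rdot (A w) x - rdot w y = rdot w (A (x_ k) - y) - rdot (A w) (x_ k - x).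
  by rewrite !rdotBr (selfadjoint_sym sA Dw (Dx k)); ring.
rewrite (le_trans (ler_normB _ _))// mulrDl lerD// -mulrA.
  by rewrite (le_trans (rdot_abs_le _ _))// ler_wpM2l ?nrm_ge0.
by rewrite (le_trans (rdot_abs_le _ _))// ler_wpM2l ?nrm_ge0.
Qed.

Definition op_shift A z f := A f - z%:C *: f.

Lemma op_shiftB A z w f : op_shift A z f - w%:C *: f = A f - (z + w)%:C *: f.
Proof. by apply: rdot_inj => v; rewrite !rdotE; ring. Qed.

Lemma op_shift_real_linear A z : selfadjoint A ->
  real_linear_on (odom A) (op_shift A z).
Proof.
move=> sA; have L := selfadjoint_real_linear sA; split; first exact: L.1.
move=> a x y Dx Dy; have [D1 A1] := L.2 a x y Dx Dy; split=> //.
by apply: rdot_inj => v; rewrite /op_shift A1 !rdotE; ring.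
Qed.

Lemma op_shift_sym A z : selfadjoint A -> symmetric_on (odom A) (op_shift A z).
Proof.
by move=> sA x y Dx Dy; rewrite /op_shift !rdotE (selfadjoint_sym sA Dx Dy).
Qed.

Lemma op_shift_closed A z : selfadjoint A -> closed_op (odom A) (op_shift A z).
Proof.
move=> sA x_ C x y Dx xC yC.
have C0 : 0 <= C.
  by have := le_trans (nrm_ge0 _) (xC 0%N); rewrite invr1 mulr1.
have [||D1 A1] := selfadjoint_closed sA (C := C + `|z| * C) (x := x)
    (y := y + z%:C *: x) Dx.
- by move=> k; rewrite (le_trans (xC k))// ler_wpM2r// lerDl mulr_ge0.
- move=> k.
  have -> : A (x_ k) - (y + z%:C *: x) =
      op_shift A z (x_ k) - y + z%:C *: (x_ k - x).
    by apply: rdot_inj => v; rewrite /op_shift !rdotE; ring.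
  by rewrite (le_trans (nrmD _ _))// mulrDl lerD// nrmZr -mulrA ler_wpM2l.
by split=> //; rewrite /op_shift A1 addrK.
Qed.

Lemma resolvent_coercive A z : resolvent_set A z%:C -> coercive_on (odom A) A z.
Proof.
move=> [B [/linear_bounded[M M0 BM] BA _]]; exists M^-1; first by rewrite invr_gt0.
by move=> f Df; rewrite ler_pdivrMl// -{1}(BA f Df).
Qed.

Lemma resolvent_onto A z f : resolvent_set A z%:C ->
  exists2 g, odom A g & A g - z%:C *: g = f.
Proof. by move=> [B [_ _ AB]]; have [DB ABf] := AB f; exists (B f). Qed.

Definition eigenortho A z := rortho [set x | odom A x /\ A x = z%:C *: x].

Definition isolated_or_regular A z := exists2 e : R, 0 < e &
  forall t, 0 < `|t - z| < e -> resolvent_set A t%:C.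

Section EigenvalueRemoved.
Variables (A : operator E) (l : R).
Hypothesis sA : selfadjoint A.
Hypothesis l_isol : isolated_or_regular A l.

Let K := op_shift A l.

Lemma eigenorthoE : eigenortho A l = rortho [set x | odom A x /\ K x = 0].
Proof.
rewrite /eigenortho; congr rortho; apply/seteqP.
split=> x [Dx Kx]; split=> //; first by rewrite /K /op_shift Kx subrr.
by apply/eqP; rewrite -subr_eq0; apply/eqP.
Qed.

Lemma eigenortho_coercive : exists2 d : R, 0 < d &
  forall f, odom A f -> eigenortho A l f -> d * nrm f <= nrm (A f - l%:C *: f).
Proof.
have [e e0 eP] := l_isol; exists e => // f Df.
rewrite eigenorthoE; apply: (@isolated_coercive _ _ (odom A) K e e0) => //.
- exact: op_shift_real_linear.
- exact: op_shift_sym.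
- exact: op_shift_closed.
- move=> z ze; have [|d d0 dP] := @resolvent_coercive A (l + z).
    by apply: eP; rewrite addrAC subrr add0r.
  by exists d => // g Dg; rewrite op_shiftB; exact: dP.
- move=> z ze g; have [|h Dh hE] := @resolvent_onto A (l + z) g.
    by apply: eP; rewrite addrAC subrr add0r.
  by exists h => //; rewrite op_shiftB.
Qed.

Lemma eigenortho_onto y : eigenortho A l y ->
  exists f, [/\ odom A f, eigenortho A l f & A f - l%:C *: f = y].
Proof.
have [e e0 eP] := l_isol.
rewrite eigenorthoE; apply: (@isolated_onto _ _ (odom A) K e e0) => //.
- exact: op_shift_real_linear.
- exact: op_shift_sym.
- exact: op_shift_closed.
- move=> z ze; have [|d d0 dP] := @resolvent_coercive A (l + z).
    by apply: eP; rewrite addrAC subrr add0r.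
  by exists d => // g Dg; rewrite op_shiftB; exact: dP.
- move=> z ze g; have [|h Dh hE] := @resolvent_onto A (l + z) g.
    by apply: eP; rewrite addrAC subrr add0r.
  by exists h => //; rewrite op_shiftB.
Qed.

(** For [z != l] the resolvent preserves the complement: pairing the equation with an eigenvector
    [x] gives [(l - z) (f, x) = 0]. *)
Lemma eigenortho_solve z y : (z != l -> resolvent_set A z%:C) ->
  eigenortho A l y ->
  exists f, [/\ odom A f, eigenortho A l f & A f - z%:C *: f = y].
Proof.
move=> zP; have [->|zl] := eqVneq z l; first exact: eigenortho_onto.
have [f Df fE] := resolvent_onto y (zP zl); move=> yN; exists f; split=> //.
move=> x [Dx Ax]; have := yN x (conj Dx Ax); rewrite -fE rdotBl rdotZl.
rewrite (selfadjoint_sym sA Df Dx) Ax rdotZr -mulrBl => /eqP.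
by rewrite mulf_eq0 subr_eq0 eq_sym (negPf zl) => /eqP.
Qed.

(** The gap inequality for [A] restricted to the complement of the eigenspace, where [l] has become
    a regular point. *)
Lemma eigenortho_gap a b f : a < b ->
  (forall z, a < z < b -> z != l -> resolvent_set A z%:C) ->
  odom A f -> eigenortho A l f ->
  0 <= rdot (A f - a%:C *: f) (A f - b%:C *: f).
Proof.
move=> ab abP Df fN; pose D := [set x | odom A x /\ eigenortho A l x].
have L := selfadjoint_real_linear sA.
apply: (@gap_form_ge0 _ _ D) => //.
- split; first by split; [exact: L.1|move=> x _; rewrite rdot0l].
  move=> c x y [Dx xN] [Dy yN]; have [D1 A1] := L.2 c x y Dx Dy; split=> //.
  split=> // v Nv; rewrite rdotDl rdotZl.
  by rewrite (xN v Nv) (yN v Nv) mulr0 addr0.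
- by move=> x y [Dx _] [Dy _]; exact: selfadjoint_sym.
- move=> z zab; have [->|zl] := eqVneq z l.
    by have [d d0 dP] := eigenortho_coercive; exists d => // g [Dg gN]; exact: dP.
  by have [d d0 dP] := resolvent_coercive (abP z zab zl); exists d => // g [Dg _]; exact: dP.
- move=> z zab g [_ gN]; have [h [Dh hN hE]] := eigenortho_solve (abP z zab) gN.
  by exists h.
Qed.

End EigenvalueRemoved.
End SelfadjointOperators.

(** * The spectrum below the essential spectrum *)

Section GapBound.
Variables (R : realType) (E : hilbertSpace R).
Variables (A : operator E) (l mu G : R).
Hypothesis sA : selfadjoint A.
Hypothesis l_isol : isolated_or_regular A l.
Hypothesis mu0 : 0 < mu.
Hypothesis spG : forall z : R, spectrum A z%:C -> z != l ->
  mu * z <= G ^+ 2 * (z - mu) ^+ 2.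

(* The inequality [tau (z - mu)^2 < mu z] cuts out an interval whose endpoints
   have product [mu^2], and which by hypothesis contains no point of the
   spectrum except possibly [l]. *)
Lemma gap_resolvent_bound f (tau : R) : odom A f -> eigenortho A l f ->
  G ^+ 2 < tau ->
  mu * rdot (A f) f <= tau * rdot (A f - mu%:C *: f) (A f - mu%:C *: f).
Proof.
move=> Df fN Gtau; have tau0 : 0 < tau := le_lt_trans (sqr_ge0 G) Gtau.
(* The roots of [tau * (z - mu) ^+ 2 = mu * z] are [mu + d - rho] and [mu + d + rho]. The strict
   bound on [tau] makes it positive even when [G = 0]. *)
pose d := mu / (2 * tau).
have d0 : 0 < d by rewrite divr_gt0// mulr_gt0.
have taud : 2 * tau * d = mu by rewrite /d; field; rewrite gt_eqF.
pose rho := Num.sqrt ((mu + d) ^+ 2 - mu ^+ 2).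
have rho2 : rho ^+ 2 = (mu + d) ^+ 2 - mu ^+ 2.
  by rewrite sqr_sqrtr//; have := mulr_gt0 mu0 d0; have := sqr_ge0 d; nra.
have rho0 : 0 < rho.
  by rewrite sqrtr_gt0; have := mulr_gt0 mu0 d0; have := sqr_ge0 d; nra.
have : 0 <= rdot (A f - (mu + d - rho)%:C *: f) (A f - (mu + d + rho)%:C *: f).
  apply: (eigenortho_gap sA l_isol) => //; first by lra.
  move=> z /andP[az zb] zl; apply: contrapT => /spG/(_ zl).
  have H1 : (z - (mu + d - rho)) * (z - (mu + d + rho)) < 0 by rewrite nmulr_llt0; lra.
  have H2 : tau * (z - mu) ^+ 2 < mu * z.
    have := H1; rewrite -(pmulr_rlt0 _ tau0).
    suff -> : tau * ((z - (mu + d - rho)) * (z - (mu + d + rho))) =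
      tau * (z - mu) ^+ 2 - mu * z by lra.
    transitivity (tau * (z ^+ 2 - 2 * mu * z + (mu + d) ^+ 2 - rho ^+ 2) -
      2 * tau * d * z); first by ring.
    by rewrite rho2 taud; ring.
  have := ler_wpM2r (sqr_ge0 (z - mu)) (ltW Gtau); lra.
have -> : rdot (A f - (mu + d - rho)%:C *: f) (A f - (mu + d + rho)%:C *: f) =
    rdot (A f - mu%:C *: f) (A f - mu%:C *: f) - 2 * d * rdot (A f) f.
  transitivity (rdot (A f) (A f) - 2 * (mu + d) * rdot (A f) f +
     ((mu + d) ^+ 2 - rho ^+ 2) * rdot f f).
    by rewrite !rdotE (rdotC f (A f)); ring.
  by rewrite rho2 !rdotE (rdotC f (A f)); ring.
rewrite -(pmulr_rge0 _ tau0) mulrBr subr_ge0; congr (_ <= _).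
by rewrite -[in RHS]taud; ring.
Qed.

(** Unless [mu = l], the point [mu] is regular: in the spectrum it would satisfy [mu * mu <= 0] by
    [spG]. *)
Lemma spectral_gap_solve y : eigenortho A l y ->
  exists f, [/\ odom A f, eigenortho A l f & A f - mu%:C *: f = y].
Proof.
apply: eigenortho_solve => // mul; apply: contrapT => /spG/(_ mul).
by rewrite subrr expr0n mulr0 leNgt mulr_gt0.
Qed.

End GapBound.

Section DiscreteEigenvalues.
Variables (R : realType) (E : hilbertSpace R).
Variables (A : operator E) (lam : nat -> \bar R).
Hypothesis lamP : discrete_eigenvalues A lam.
Implicit Types (t z : R) (x : E).

Lemma eigenvalue_spectrum z x : odom A x -> A x = z%:C *: x -> x != 0 ->
  spectrum A z%:C.
Proof.
move=> Dx Ax /eqP x0 [B [_ BA _]]; apply: x0.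
by rewrite -(BA x Dx) Ax subrr linear0.
Qed.

Lemma has_dim_neq0 (V : set E) m : has_dim V m -> (0 < m)%N ->
  exists2 x, V x & x != 0.
Proof.
case: m => // m [b [bfree ->]] _.
exists (b ord0).
  exists (fun l => (l == ord0)%:R) => //.
  rewrite (bigD1 ord0)//= scale1r big1 ?addr0// => l /negPf ->.
  by rewrite scale0r.
apply/eqP => b0; have : \sum_l ((l == ord0)%:R : R[i]) *: b l = 0.
  rewrite (bigD1 ord0)//= b0 scaler0 add0r big1// => l /negPf ->.
  by rewrite scale0r.
by move=> /(bfree (fun l => (l == ord0)%:R))/(_ ord0)/eqP; rewrite eqxx oner_eq0.
Qed.

Lemma has_dim_gt0 (V : set E) m x : has_dim V m -> V x -> x != 0 -> (0 < m)%N.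
Proof.
case: m => // [[b [_ ->]] [a _ <-]]; by rewrite big_ord0 eqxx.
Qed.

Lemma lam_dim t : (t%:E < lambda_e A)%E -> exists m,
  has_dim (op_eigenspace A t%:C) m /\ ([set k | lam k = t%:E] #= `I_m)%card.
Proof. by have [_ _] := lamP; apply. Qed.

Lemma lam_eigenvector k t : (t%:E < lambda_e A)%E -> lam k = t%:E ->
  exists x, [/\ odom A x, A x = t%:C *: x & x != 0].
Proof.
move=> te lk; have [m [dimm cardm]] := lam_dim te.
have m0 : (0 < m)%N.
  case: m cardm {dimm} => //; rewrite II0 card_eq0 => /eqP S0.
  by have : [set k | lam k = t%:E] k by []; rewrite S0.
by have [x [Dx Ax] x0] := has_dim_neq0 dimm m0; exists x.
Qed.

Lemma discrete_below z : (z%:E < lambda_e A)%E -> spectrum A z%:C ->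
  discrete_spectrum A z%:C.
Proof.
move=> ze sz; apply: contrapT => ndz; move: ze; apply/negP; rewrite -leNgt.
by apply: ereal_inf_lbound; exists z.
Qed.

Lemma spectrum_below z : (z%:E < lambda_e A)%E -> spectrum A z%:C ->
  exists k, lam k = z%:E.
Proof.
move=> ze /(discrete_below ze)[_ [m m0 dimm]].
have [x Vx x0] := has_dim_neq0 dimm m0; have [m' [dimm' cardm']] := lam_dim ze.
apply: contrapT => nk; have := has_dim_gt0 dimm' Vx x0.
have : [set k | lam k = z%:E] = set0.
  by apply/seteqP; split=> // k lk; apply: nk; exists k.
move=> S0; move: cardm'; rewrite S0 card_eq_sym card_eq0.
by case: m' {dimm'} => // m' /eqP/seteqP[/(_ 0%N)].
Qed.

Lemma lam_isolated k z : (z%:E < lambda_e A)%E -> lam k = z%:E ->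
  isolated_or_regular A z.
Proof.
move=> ze /(lam_eigenvector ze)[x [Dx Ax x0]].
have [[_ [V Vz Vsp]] _] := discrete_below ze (eigenvalue_spectrum Dx Ax x0).
have /nbhs_ballP[e /= e0 eV] := Vz.
have e'0 : 0 < complex.Re e by move: e0; rewrite ltcE => /andP[].
exists (complex.Re e) => // t /andP[tz0 te]; apply: contrapT => spt.
have : (V `&` spectrum A) t%:C.
  split=> //; apply: eV; rewrite -ball_normE /= -rmorphB normc_def /=.
  rewrite expr0n addr0 sqrtr_sqr distrC -(RRe_real (gtr0_real e0)).
  by rewrite ltcR.
rewrite Vsp => /= /complexI tz; move: tz0.
by rewrite tz subrr normr0 ltxx.
Qed.

(** Otherwise all entries stay at or below [t]. Their supremum [L] is then in the spectrum below
    [lambda_e A], hence is one of the entries; by monotonicity all later entries equal [L], against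
    its finite multiplicity. *)
Lemma lam_tail t : (t%:E < lambda_e A)%E ->
  exists k0, forall k, (k0 <= k)%N -> (t%:E < lam k)%E.
Proof.
move=> te; have [lam_nd lam_bnd _] := lamP.
have [[k0 k0P]|nok] := pselect (exists k0, (t%:E < lam k0)%E).
  by exists k0 => k kk; apply: lt_le_trans k0P _; exact: lam_nd.
have lamt k : (lam k <= t%:E)%E.
  by rewrite leNgt; apply/negP => tk; apply: nok; exists k.
pose r k := fine (lam k).
have lamE k : lam k = (r k)%:E.
  rewrite /r fineK// ge0_fin_numE; first exact: le_lt_trans (lamt k) (ltry _).
  by have /andP[] := lam_bnd k.
have rt k : r k <= t by rewrite -lee_fin -lamE.
have re k : ((r k)%:E < lambda_e A)%E by apply: le_lt_trans te; rewrite lee_fin.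
have rsup : has_sup (range r) by split; [exists (r 0%N), 0%N|exists t => _ [k _ <-]].
set L := sup (range r).
have rL k : r k <= L by apply: ub_le_sup; [exact: rsup.2|exists k].
have Lt : L <= t by apply: ge_sup; [exact: rsup.1|move=> _ [k _ <-]].
have Le : (L%:E < lambda_e A)%E by apply: le_lt_trans te; rewrite lee_fin.
(* Eigenvalues come within any [d] of [L], and their eigenvectors violate the coercivity of
   [A - L]. *)
have spL : spectrum A L%:C.
  move=> /resolvent_coercive[d d0 dP].
  have [_ [k _ <-] dk] := sup_adherent d0 rsup.
  have [x [Dx Ax x0]] := lam_eigenvector (re k) (lamE k).
  have := dP x Dx; rewrite Ax -real_scaleBl nrmZr ler_pM2r; last first.
    by rewrite lt_def nrm_eq0 x0 nrm_ge0.
  by rewrite distrC ger0_norm ?subr_ge0// -/L; move: dk; rewrite -/L; lra.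
have [k1 lk1] := spectrum_below Le spL.
have [m [_ cardm]] := lam_dim Le.
have /finite_seqP[s sE] : finite_set [set k | lam k = L%:E] by exists m.
have tail k : (k1 <= k)%N -> k \in s.
  move=> kk; have : [set k | lam k = L%:E] k; last by rewrite sE.
  rewrite /= lamE; congr (_%:E); apply/le_anti; rewrite rL/= -lee_fin -lamE -lk1.
  exact: lam_nd.
have := tail (k1 + (\max_(j <- s) j).+1)%N (leq_addr _ _) => ins.
have := @leq_bigmax_seq _ s xpredT id _ ins erefl.
by rewrite leqNgt addnS ltnS leq_addl.
Qed.

End DiscreteEigenvalues.

(** * The gap ratio along the spectrum *)

Section GapRatio.
Variable R : realType.
Implicit Types (mu z y G : R) (l : \bar R).

Lemma gap_ratio_ge0 mu l : (0 <= gap_ratio mu l)%E.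
Proof. by case: l => [r| |] //=; rewrite lee_fin divr_ge0// sqrtr_ge0. Qed.

Lemma gap_ratio_fin mu l : gap_ratio mu l = (fine (gap_ratio mu l))%:E.
Proof. by case: l. Qed.

Lemma gap_ratio_le mu z G : 0 <= mu * z -> z != mu ->
  (gap_ratio mu z%:E <= G%:E)%E -> mu * z <= G ^+ 2 * (z - mu) ^+ 2.
Proof.
move=> muz zmu; have d0 : 0 < `|z - mu| by rewrite normr_gt0 subr_eq0.
rewrite /= lee_fin ler_pdivrMr// => H; rewrite -[X in X <= _]sqr_sqrtr//.
rewrite -[X in _ ^+ 2 * X]real_normK ?num_real// -exprMn ler_sqr ?nnegrE ?sqrtr_ge0//.
exact: le_trans (sqrtr_ge0 _) H.
Qed.

Lemma gap_ratio_le_sqr mu z G : 0 <= G -> z != mu ->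
  mu * z <= G ^+ 2 * (z - mu) ^+ 2 -> (gap_ratio mu z%:E <= G%:E)%E.
Proof.
move=> G0 zmu; have d0 : 0 < `|z - mu| by rewrite normr_gt0 subr_eq0.
rewrite -[X in _ ^+ 2 * X]real_normK ?num_real// -exprMn => H.
rewrite /= lee_fin ler_pdivrMr// -[leRHS]ger0_norm ?mulr_ge0// -sqrtr_sqr.
exact: ler_wsqrtr.
Qed.

Lemma gap_ratio_mono mu y z : 0 < mu -> mu < y <= z ->
  (gap_ratio mu z%:E <= gap_ratio mu y%:E)%E.
Proof.
move=> mu0 /andP[muy yz]; rewrite [leRHS]gap_ratio_fin.
apply: gap_ratio_le_sqr; first by rewrite -lee_fin -gap_ratio_fin gap_ratio_ge0.
  by rewrite gt_eqF// (lt_le_trans muy).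
have ym0 : 0 < (y - mu) ^+ 2 by rewrite exprn_gt0// subr_gt0.
have muy0 : 0 <= mu * y by apply: mulr_ge0; lra.
rewrite /= expr_div_n sqr_sqrtr//.
rewrite real_normK ?num_real// mulrAC ler_pdivlMr//.
(* [y (z - mu)^2 - z (y - mu)^2 = (z - y) (z y - mu^2)]. *)
suff : 0 <= mu * ((z - y) * (z * y - mu ^+ 2)) by lra.
rewrite mulr_ge0 ?(ltW mu0)// mulr_ge0 ?subr_ge0// expr2.
by apply: ler_pM; lra.
Qed.

End GapRatio.

Section GapConstant.
Variables (R : realType) (E : hilbertSpace R).
Variables (A : operator E) (lam : nat -> \bar R) (i : nat -> nat).
Variables (j : nat) (mu l : R).
Hypothesis lamP : discrete_eigenvalues A lam.
Hypothesis i_bij : bijective i.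
Hypothesis mu0 : 0 < mu.
Hypothesis mue : (mu%:E < lambda_e A)%E.
Hypothesis lamj : lam (i j) = l%:E.
Hypothesis no_mu : forall k, k != j -> lam (i k) <> mu%:E.

Let gaps := [set gap_ratio mu (lam (i k)) | k in [set k | k != j]].

Lemma gap_sup_fin : exists2 G : R, 0 <= G & ereal_sup gaps = G%:E.
Proof.
have [lam_nd lam_bnd _] := lamP; have [k0 k0P] := lam_tail lamP mue.
pose r k := fine (gap_ratio mu (lam k)).
have r0 k : 0 <= r k by rewrite -lee_fin -gap_ratio_fin gap_ratio_ge0.
(* A sum of nonnegative terms dominates each of them, and from [k0] on the entries exceed [mu],
   where the ratio decreases. An entry equal to [mu] or to [+oo] has ratio 0. *)
pose M := \sum_(k < k0.+1) r k.
have rM k : r k <= M.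
  wlog kk0 : k / (k <= k0)%N.
    move=> H; have [kk|kk] := leqP k k0; first exact: H.
    apply: le_trans (H k0 (leqnn _)); have := lam_nd _ _ (ltnW kk).
    have := k0P k0 (leqnn _); rewrite -lee_fin -!gap_ratio_fin.
    case: (lam k0) => [y| |]; case: (lam k) => [z| |]//; last first.
      by move=> _ _; exact: gap_ratio_ge0.
    by rewrite lte_fin lee_fin => my yz; apply: gap_ratio_mono => //; rewrite my.
  have kk1 : (k < k0.+1)%N by rewrite ltnS.
  rewrite /M (bigD1 (Ordinal kk1))//= lerDl.
  by apply: sumr_ge0.
have sup_le : (ereal_sup gaps <= M%:E)%E.
  by apply: ge_ereal_sup => _ [k _ <-]; rewrite gap_ratio_fin lee_fin; exact: rM.
have sup_ge0 : (0 <= ereal_sup gaps)%E.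
  apply: le_trans (gap_ratio_ge0 mu (lam (i j.+1))) _.
  apply: ereal_sup_ubound; exists j.+1 => //=.
  by rewrite eqn_leq ltnn.
have fin : ereal_sup gaps \is a fin_num.
  by rewrite ge0_fin_numE// (le_lt_trans sup_le)// ltry.
exists (fine (ereal_sup gaps)); last by rewrite fineK.
exact: fine_ge0.
Qed.

Lemma gap_sup_spectrum (G : R) : ereal_sup gaps = G%:E ->
  forall z : R, spectrum A z%:C -> z != l -> mu * z <= G ^+ 2 * (z - mu) ^+ 2.
Proof.
move=> supE z spz zl; have [lam_nd lam_bnd _] := lamP.
have [z0|z0] := ltP z 0.
  by rewrite (@le_trans _ _ 0)//; [rewrite pmulr_rle0// ltW|rewrite mulr_ge0 ?sqr_ge0].
have muz : 0 <= mu * z by rewrite mulr_ge0// ltW.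
have inG k : k != j -> (gap_ratio mu (lam (i k)) <= G%:E)%E.
  by move=> kj; rewrite -supE; apply: ereal_sup_ubound; exists k.
have [i' i'K iK] := i_bij.
have [ze|ez] := ltP z%:E (lambda_e A).
  have [k lamk] := spectrum_below lamP ze spz.
  have kj : i' k != j.
    apply: contra_neq zl => kj; apply/eqP; rewrite -eqe -lamj -lamk -kj iK.
    exact: eqxx.
  apply: gap_ratio_le => //.
    apply/eqP => zmu; apply: (no_mu kj); by rewrite iK lamk zmu.
  by rewrite -lamk -(iK k); exact: inG.
(* No entry need equal [z] here. An entry beyond [k0] lies above [mu] and at most at
   [lambda_e A <= z], so by monotonicity its ratio dominates that of [z]; the shift by [(i j).+1]
   keeps [k] away from [i j]. *)
have [k0 k0P] := lam_tail lamP mue; pose k := (k0 + (i j).+1)%N.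
have kj : i' k != j.
  apply: contra_eq_neq (iK k) => ->.
  by rewrite /k neq_ltn addnS ltnS leq_addl.
have := inG _ kj; rewrite iK => ratk; have := k0P k (leq_addr _ _).
have /andP[_] := lam_bnd k => /le_trans/(_ ez).
case: (lam k) ratk => [y| |]// ratk; rewrite lee_fin lte_fin => yz muy.
apply: gap_ratio_le => //; first by rewrite gt_eqF// (lt_le_trans muy).
by apply: le_trans ratk; apply: gap_ratio_mono => //; rewrite muy.
Qed.

End GapConstant.

(** * Principal angles *)

Section Projections.
Variables (R : realType) (E : hilbertSpace R).
Implicit Types (V W : set E) (x y z : E).

Lemma hdotBl x y z : '[x - y, z] = '[x, z] - '[y, z].
Proof. exact: linearBl. Qed.

Lemma hdot_eq0C x y : '[x, y] = 0 -> '[y, x] = 0.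
Proof. by move=> xy; rewrite (hdotC x y) xy conjc0. Qed.

Definition is_proj V x y := V y /\ forall z, V z -> '[x - y, z] = 0.

Definition has_proj V := forall x, exists y, is_proj V x y.

(** Where no projection exists [oproj] takes the default 0, so the contraction estimates hold for
    arbitrary sets. *)
Lemma oprojP V x : is_proj V x (oproj V x) \/ oproj V x = 0.
Proof. by rewrite /oproj; case: xgetP => [y -> [Vy yP]|]; [left|right]. Qed.

Lemma oproj_eq V x y : is_proj V x y -> oproj V x = y.
Proof.
move=> [Vy yP]; rewrite /oproj; case: xgetP => [y' _ [Vy' y'P]|/(_ y)[]]//.
have yy z : V z -> '[y' - y, z] = 0.
  move=> Vz; have := y'P z Vz; have := yP z Vz; rewrite !hdotBl.
  by move=> /eqP; rewrite subr_eq0 => /eqP <- /eqP; rewrite subr_eq0 => /eqP ->; rewrite subrr.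
apply/eqP; rewrite -subr_eq0 -normr_eq0 -sqrf_eq0 -hdotE linearBr.
by rewrite /= (yy _ Vy') (yy _ Vy) subrr.
Qed.

Lemma is_proj_pythagoras V x y : is_proj V x y ->
  nrm x ^+ 2 = nrm y ^+ 2 + nrm (x - y) ^+ 2.
Proof.
move=> [Vy yP]; have : rdot (x - y) y = 0 by rewrite /rdot yP.
by rewrite -!rdotxx !rdotE (rdotC y x); lra.
Qed.

Lemma nrm_oproj V x : nrm (oproj V x) <= nrm x.
Proof.
have [/is_proj_pythagoras H|->] := oprojP V x; last by rewrite nrm0 nrm_ge0.
by rewrite -ler_sqr ?nnegrE ?nrm_ge0// H lerDl sqr_ge0.
Qed.

Lemma nrm_oprojC V x : nrm (x - oproj V x) <= nrm x.
Proof.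
have [/is_proj_pythagoras H|->] := oprojP V x; last by rewrite subr0.
by rewrite -ler_sqr ?nnegrE ?nrm_ge0// H lerDr sqr_ge0.
Qed.

Section Contraction.
Variable T : E -> E.
Hypothesis T_contr : forall x, nrm (T x) <= nrm x.

Lemma opnorm_has_sup : has_sup [set nrm (T x) | x in [set x : E | nrm x <= 1]].
Proof.
split; first by exists (nrm (T 0)), 0 => //=; rewrite nrm0.
by exists 1 => _ [x /= x1 <-]; exact: le_trans (T_contr x) x1.
Qed.

Lemma opnorm_ge x : nrm x <= 1 -> nrm (T x) <= opnorm T.
Proof. by move=> x1; apply: ub_le_sup; [exact: opnorm_has_sup.2|exists x]. Qed.

Lemma opnorm_bounds : 0 <= opnorm T <= 1.
Proof.
apply/andP; split.
  by apply: le_trans (nrm_ge0 (T 0)) _; apply: opnorm_ge; rewrite nrm0.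
apply: ge_sup; first exact: opnorm_has_sup.1.
by move=> _ [x /= x1 <-]; exact: le_trans (T_contr x) x1.
Qed.

End Contraction.

Lemma oprojM_contr V W x : nrm (oproj V (x - oproj W x)) <= nrm x.
Proof. exact: le_trans (nrm_oproj _ _) (nrm_oprojC _ _). Qed.

Lemma sin_max_principal_angle V W : sin (max_principal_angle V W) =
  Num.min (opnorm (fun x => oproj V (x - oproj W x)))
          (opnorm (fun x => oproj W (x - oproj V x))).
Proof.
have /andP[a0 a1] := opnorm_bounds (oprojM_contr V W).
have /andP[b0 b1] := opnorm_bounds (oprojM_contr W V).
rewrite /max_principal_angle asinK// in_itv /= le_min ge_min a1 /=.
by rewrite (le_trans (lerN10 _) a0) (le_trans (lerN10 _) b0).
Qed.

Lemma has_proj_add1 V V' b : lin_subspace V -> has_proj V ->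
  V' = [set v + c *: b | v in V & c in [set: R[i]]] -> has_proj V'.
Proof.
move=> [V0 VL] projV -> x; have [p [Vp pP]] := projV x; have [q [Vq qP]] := projV b.
(* A Gram-Schmidt step. If [b] is already in [V], then [d = 0] and the quotient is 0 by
   convention. *)
pose d := b - q; pose c := '[x - p, d] / '[d, d].
exists (p + c *: d); split.
  exists (- c *: q + p); first exact: VL.
  by exists c => //; rewrite /d scalerBr scaleNr addrAC addrC addrA addrAC addrA.
have xdV v : V v -> '[x - (p + c *: d), v] = 0.
  by move=> Vv; rewrite opprD addrA hdotBl linearZl_LR /= pP// qP// mulr0 subrr.
have xdd : '[x - (p + c *: d), d] = 0.
  rewrite opprD addrA hdotBl linearZl_LR /= /c; have [->|d0] := eqVneq d 0.
    by rewrite linear0r !mul0r subrr.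
  by rewrite divfK ?subrr// hdotE sqrf_eq0 normr_eq0.
move=> _ [v Vv [a _ <-]]; rewrite linearDr /= xdV// add0r linearZr_LR /=.
by rewrite -(subrK q b) linearDr /= -/d xdd add0r xdV// mulr0.
Qed.

Lemma has_proj_range n (T : 'cV[R[i]]_n -> E) :
  (forall c a b, T (c *: a + b) = c *: T a + T b) -> has_proj (range T).
Proof.
elim: n => [|n IH] in T *; move=> TL; have T0 : T 0 = 0.
- by have := TL (-1) 0 0; rewrite scaler0 addr0 scaleN1r addNr.
- move=> x; exists 0; split; first by exists 0.
  by move=> _ [a _ <-]; rewrite (flatmx0 a) T0 linear0r.
- by have := TL (-1) 0 0; rewrite scaler0 addr0 scaleN1r addNr.
pose T1 (a : 'cV[R[i]]_n) := T (col_mx (0 : 'cV_1) a).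
have T1L c a b : T1 (c *: a + b) = c *: T1 a + T1 b.
  have -> : T1 (c *: a + b) = T (c *: col_mx (0 : 'cV[R[i]]_1) a + col_mx 0 b).
    by rewrite scale_col_mx add_col_mx scaler0 addr0.
  exact: TL.
have T10 : T1 0 = 0 by rewrite /T1 col_mx0.
apply: (@has_proj_add1 (range T1) _ (T (col_mx (1%:M : 'cV_1) 0))).
- split; first by exists 0.
  by move=> c _ _ [a _ <-] [b _ <-]; exists (c *: a + b).
- exact: IH.
apply/seteqP; split=> [_ [a _ <-]|_ [_ [a _ <-] [c _ <-]]].
  exists (T1 (dsubmx (a : 'cV_(1 + n)))); first by exists (dsubmx (a : 'cV_(1 + n))).
  pose c := (usubmx (a : 'cV[R[i]]_(1 + n))) 0 0; exists c => //.
  have aE : a = c *: col_mx (1%:M : 'cV_1) 0 + col_mx 0 (dsubmx (a : 'cV_(1 + n))).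
    rewrite scale_col_mx add_col_mx scaler0 add0r addr0 scalemx1.
    by rewrite -mx11_scalar vsubmxK.
  rewrite [in RHS]aE addrC; exact/esym/TL.
exists (c *: col_mx (1%:M : 'cV_1) 0 + col_mx 0 a) => //.
by rewrite [RHS]addrC; exact: TL.
Qed.

End Projections.

Section RangeProjection.
Variables (R : realType) (E : hilbertSpace R) (n : nat).
Variable X : {linear 'cV[R[i]]_n -> E}.
Hypothesis X_iso : isometric X.

Let e (l : 'I_n) := X (delta_mx l 0).

Lemma linear_sum_delta a : X a = \sum_l a l 0 *: e l.
Proof.
rewrite {1}(matrix_sum_delta a) linear_sum; apply: eq_bigr => l _.
by rewrite big_ord1 linearZ.
Qed.

Lemma hdot_range_proj w a : '[w - range_proj X w, X a] = 0.
Proof.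
rewrite hdotBl X_iso /cdot {1}linear_sum_delta linear_sumr.
rewrite -sumrB big1// => l _.
by rewrite linearZr_LR /= mxE mulrC subrr.
Qed.

Lemma range_projK a : range_proj X (X a) = X a.
Proof.
apply/eqP; rewrite eq_sym -subr_eq0 -normr_eq0 -sqrf_eq0 -hdotE.
by have := hdot_range_proj (X a) (a - adj X (X a)); rewrite linearB => ->.
Qed.

Lemma range_range_proj : range (range_proj X) = range X.
Proof.
apply/seteqP; split=> _ [a _ <-]; first by exists (adj X a).
by exists (X a); rewrite ?range_projK.
Qed.

Lemma range_riesz (T : 'cV[R[i]]_n -> E) y : linear T ->
  forall a, '[X a, X (adj T y)] = '[T a, y].
Proof.
move=> TL a; pose T' : {linear 'cV[R[i]]_n -> E} :=
  HB.pack T (GRing.isLinear.Build _ _ _ _ T TL).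
have -> : T a = \sum_l a l 0 *: T (delta_mx l 0).
  have -> : T a = T' a by [].
  rewrite {1}(matrix_sum_delta a) linear_sum; apply: eq_bigr => l _.
  by rewrite big_ord1 linearZ.
rewrite X_iso /cdot linear_sumlz; apply: eq_bigr => l _.
by rewrite linearZl_LR /= mxE [in RHS](hdotC y).
Qed.

End RangeProjection.

(** * The sine of the principal angle as a bound on inner products *)

Section Angle.
Variables (R : realType) (E : hilbertSpace R) (n : nat).
Variable X : {linear 'cV[R[i]]_n -> E}.
Variables A As : operator E.
Hypothesis X_iso : isometric X.
Hypothesis sAs : selfadjoint As.
Hypothesis AsA : op_eq (op_square As) A.
Hypothesis X_dom : forall a, odom As (X a).
Hypothesis A_inj : (forall x, odom A x -> A x = 0 -> x = 0) ->
  resolvent_set A 0%:C.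

Let V := As @` range X.
Let W := inv_image As (range X).
Let s := sin (max_principal_angle V W).

Let AsX_linear : linear (fun a => As (X a)).
Proof. by have [[_ AL] _ _] := sAs; move=> c a b; rewrite linearP AL. Qed.

Let As0 : As 0 = 0.
Proof. exact: real_linear_on0 (selfadjoint_real_linear sAs). Qed.

Let AsB x y : odom As x -> odom As y -> odom As (x - y) /\ As (x - y) = As x - As y.
Proof. exact: real_linear_onB (selfadjoint_real_linear sAs). Qed.

Lemma op_square_dom x : odom A x <-> odom As x /\ odom As (As x).
Proof. by case: AsA => <-. Qed.

Lemma op_square_fun x : odom A x -> A x = As (As x).
Proof. by case: AsA => <- H Dx; rewrite -H. Qed.

Let V_range : V = range (fun a => As (X a)).
Proof. by rewrite /V image_comp. Qed.

Lemma sin_angle_ge0 : 0 <= s.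
Proof.
have /andP[a0 _] := opnorm_bounds (@oprojM_contr _ _ V W).
have /andP[b0 _] := opnorm_bounds (@oprojM_contr _ _ W V).
by rewrite /s sin_max_principal_angle le_min a0 b0.
Qed.

(** Moving [As] to the other side puts [As y] in the range of [X], to which [w] is orthogonal. *)
Lemma inv_image_orthogonal w : odom As w -> (forall a, '[w, X a] = 0) ->
  forall y, W y -> '[As w, y] = 0.
Proof.
move=> Dw wX y [Dy [a _ Xa]].
by rewrite (selfadjoint_hdot sAs Dw Dy) -Xa wX.
Qed.

Lemma unit_scale x : x != 0 :> E -> let c := (nrm x)^-1 in
  [/\ nrm (c%:C *: x) = 1, nrm x * c = 1 & 0 < nrm x].
Proof.
move=> x0 c; have nx : 0 < nrm x by rewrite lt_def nrm_eq0 x0 nrm_ge0.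
have c0 : 0 < c by rewrite invr_gt0.
have nc : nrm x * c = 1 by rewrite divff ?gt_eqF.
by rewrite nrmZr gtr0_norm// mulrC.
Qed.

(** As [z] is orthogonal to [W], its projection onto [V] is the value at [z] of the operator whose
    norm is taken, and [(v, z)] sees only that projection. *)
Lemma first_angle_bound v z : V v -> (forall y, W y -> '[z, y] = 0) ->
  `|rdot v z| <= opnorm (fun x => oproj V (x - oproj W x)) * nrm v * nrm z.
Proof.
move=> Vv zW; set N := opnorm _.
have [->|z0] := eqVneq z 0; first by rewrite rdot0r normr0 nrm0 mulr0.
have [] := unit_scale z0; set c := _^-1 => nz zc nz0.
have Wz : oproj W (c%:C *: z) = 0.
  apply: oproj_eq; split; last by move=> y Wy; rewrite subr0 linearZl_LR /= zW// mulr0.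
  split; first exact: (selfadjoint_real_linear sAs).1.
  by exists 0 => //; rewrite linear0 As0.
have [p [Vp pP]] : exists p, is_proj V (c%:C *: z) p.
  by rewrite V_range; exact: has_proj_range AsX_linear _.
have pN : nrm p <= N.
  rewrite -(oproj_eq (conj Vp pP)) -[X in oproj V X]subr0 -[in X in _ - X]Wz.
  by apply: (opnorm_ge (@oprojM_contr _ _ V W)); rewrite nz.
have : rdot v (c%:C *: z) = rdot v p.
  apply/eqP; rewrite rdotC (rdotC v) -subr_eq0 -rdotBl /rdot pP//.
rewrite rdotZr => H; have -> : rdot v z = nrm z * rdot v p by rewrite -H mulrA zc mul1r.
rewrite normrM (gtr0_norm nz0) [leRHS]mulrC ler_pM2l// (le_trans (rdot_abs_le _ _))//.
by rewrite mulrC ler_wpM2r// nrm_ge0.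
Qed.

Section SecondAngle.
Let N := opnorm (fun x => oproj W (x - oproj V x)).
Hypothesis N1 : N < 1.

(** A kernel vector of [A] is killed by [As], hence lies in [W] and is orthogonal to [V]; this would
    force [N >= 1]. *)
Lemma second_angle_resolvent : resolvent_set A 0%:C.
Proof.
apply: A_inj => x Dx Ax; apply/eqP; apply: contraT => x0.
have [Dsx Dssx] := (op_square_dom x).1 Dx.
have Asx : As x = 0.
  apply/eqP; rewrite -nrm_eq0 -sqrf_eq0 -rdotxx.
  by rewrite (selfadjoint_sym sAs Dsx Dssx) -op_square_fun// Ax rdot0r.
have [] := unit_scale x0; set c := _^-1 => nx xc nx0.
have [Dcx Acx] := real_linear_onZ c (selfadjoint_real_linear sAs) Dsx.
have Wcx : W (c%:C *: x).
  by split=> //; exists 0 => //; rewrite linear0 Acx Asx scaler0.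
have Vcx : oproj V (c%:C *: x) = 0.
  apply: oproj_eq; split; first by exists 0; [exists 0; rewrite ?linear0|].
  move=> _ [_ [a _ <-] <-]; rewrite subr0 -(selfadjoint_hdot sAs Dcx (X_dom a)).
  by rewrite Acx Asx scaler0 linear0l.
have := opnorm_ge (@oprojM_contr _ _ W V) (x := c%:C *: x).
rewrite nx lexx => /(_ isT); rewrite Vcx subr0 (oproj_eq (y := c%:C *: x)).
  by rewrite nx -/N leNgt N1.
by split=> // z _; rewrite subrr linear0l.
Qed.

(** Since [A] is the square of [As], the inverse of [As] on the range of [X] is [As] after the
    inverse of [A]. *)
Let AsBX : exists2 Y : 'cV[R[i]]_n -> E, linear Y &
  forall a, odom As (Y a) /\ As (Y a) = X a.
Proof.
have [B [_ BA AB]] := second_angle_resolvent.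
have ABE y : odom A (B y) /\ A (B y) = y.
  by have [DB] := AB y; rewrite rmorph0 scale0r subr0.
have DsB y : odom As (B y) by have [/op_square_dom[]] := ABE y.
exists (fun a => As (B (X a))) => [c a b|a].
  by have [[_ AL] _ _] := sAs; rewrite !linearP AL.
have [Da AXa] := ABE (X a); split; first by have /op_square_dom[] := Da.
by rewrite -op_square_fun.
Qed.

Let As_inj x : odom As x -> As x = 0 -> x = 0.
Proof.
move=> Dx Asx; have [B [_ BA _]] := second_angle_resolvent.
have DAx : odom A x.
  apply/op_square_dom; rewrite Asx; split=> //.
  exact: (selfadjoint_real_linear sAs).1.
by rewrite -(BA x DAx) op_square_fun// Asx As0 rmorph0 scale0r subr0 linear0.
Qed.

Lemma inv_image_has_proj : has_proj W.
Proof.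
have [Y YL YP] := AsBX.
suff -> : W = range Y by exact: has_proj_range.
apply/seteqP; split=> [y [Dy [a _ Xa]]|_ [a _ <-]]; last first.
  by have [DY AY] := YP a; split=> //; exists a.
exists a => //; have [DY AY] := YP a; apply/esym/eqP; rewrite -subr_eq0; apply/eqP.
by have [D1 A1] := AsB Dy DY; apply: As_inj => //; rewrite A1 AY Xa subrr.
Qed.

(** With [d = y - p] orthogonal to [V], one has [|d|^2 = (d, y) = (q, y)] for the projection [q] of
    [d] onto [W], and [|q| <= N |d|]. *)
Lemma second_angle_proj y p : W y -> is_proj V y p -> nrm (y - p) <= N * nrm y.
Proof.
move=> Wy [Vp pP]; have [->|y0] := eqVneq (y - p) 0.
  have /andP[N0 _] := opnorm_bounds (@oprojM_contr _ _ W V).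
  by rewrite nrm0 mulr_ge0// nrm_ge0.
have [] := unit_scale y0; set d := y - p in y0 *; set c := _^-1 => nd dc nd0.
have Vd : oproj V (c%:C *: d) = 0.
  apply: oproj_eq; split; first by exists 0; [exists 0; rewrite ?linear0|].
  by move=> z Vz; rewrite subr0 linearZl_LR /= pP// mulr0.
have [q [Wq qP]] := inv_image_has_proj (c%:C *: d).
have qN : nrm q <= N.
  rewrite -(oproj_eq (conj Wq qP)) -[X in oproj W X]subr0 -[in X in _ - X]Vd.
  by apply: (opnorm_ge (@oprojM_contr _ _ W V)); rewrite nd.
have dy : rdot d y = nrm d ^+ 2.
  have : rdot d p = 0 by rewrite /rdot pP.
  by rewrite -rdotxx {3}/d rdotBr => ->; rewrite subr0.
have cdy : rdot q y = nrm d.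
  have : rdot (c%:C *: d - q) y = 0 by rewrite /rdot qP.
  rewrite rdotBl rdotZl dy expr2 mulrA [c * _]mulrC dc mul1r => /eqP.
  by rewrite subr_eq0 => /eqP.
by rewrite -cdy (le_trans (rdot_le _ _))// ler_wpM2r ?nrm_ge0.
Qed.

(* The projection onto [V] of the solution [w] of [As w = T^* T x], [T = As X],
   is [As x]. *)
Lemma second_angle_bound v z : V v -> (forall y, W y -> '[z, y] = 0) ->
  `|rdot v z| <= N * nrm v * nrm z.
Proof.
move=> [_ [a _ <-] vE] zW.
have /andP[N0 _] := opnorm_bounds (@oprojM_contr _ _ W V); rewrite -/N in N0.
have [Y YL YP] := AsBX; have [Dw Aw] := YP (adj (fun a => As (X a)) v).
set w := Y _ in Dw Aw.
have Ww : W w by split=> //; exists (adj (fun a => As (X a)) v).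
have pv : is_proj V w v.
  split; first by exists (X a); [exists a|].
  move=> _ [_ [b _ <-] <-]; apply: hdot_eq0C.
  rewrite linearBr /= (selfadjoint_hdot sAs (X_dom b) Dw) Aw.
  by rewrite (range_riesz X_iso v AsX_linear) subrr.
have wv := second_angle_proj Ww pv; have pyth := is_proj_pythagoras pv.
have zw : rdot w z = 0 by rewrite rdotC /rdot zW.
have vw : rdot v w = nrm v ^+ 2.
  have : rdot (w - v) v = 0 by rewrite /rdot pv.2//; exact: pv.1.
  by rewrite rdotBl rdotxx (rdotC w); lra.
have [w0|w0] := eqVneq (nrm w ^+ 2) 0.
  have /eqP : nrm v ^+ 2 = 0 by have := sqr_ge0 (nrm v); have := sqr_ge0 (nrm (w - v)); lra.
  by rewrite sqrf_eq0 => /eqP v0; rewrite (le_trans (rdot_abs_le _ _))// v0 mulr0.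
have {}w0 : 0 < nrm w ^+ 2 by rewrite lt_def w0 sqr_ge0.
(* [v - c w] is the part of [v] orthogonal to [w]; subtracting [c w] is free because [z] is
   orthogonal to [w]. *)
pose c := nrm v ^+ 2 / nrm w ^+ 2.
have -> : rdot v z = rdot (v - c%:C *: w) z by rewrite !rdotE zw mulr0 subr0.
rewrite (le_trans (rdot_abs_le _ _))// ler_wpM2r ?nrm_ge0//.
rewrite -ler_sqr ?nnegrE ?mulr_ge0 ?nrm_ge0// -rdotxx exprMn.
have -> : rdot (v - c%:C *: w) (v - c%:C *: w) =
    nrm v ^+ 2 * (nrm (w - v) ^+ 2 / nrm w ^+ 2).
  have -> : nrm (w - v) ^+ 2 = nrm w ^+ 2 - nrm v ^+ 2 by lra.
  rewrite !rdotE (rdotC w v) vw !rdotxx /c; field.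
  by rewrite -sqrf_eq0 gt_eqF.
rewrite mulrC ler_wpM2r ?sqr_ge0// ler_pdivrMr// -exprMn.
by rewrite ler_sqr ?nnegrE ?mulr_ge0 ?nrm_ge0.
Qed.

End SecondAngle.

Hypothesis s1 : s < 1.

(** Each of the two norms gives the bound, so their minimum does; when it is the second, [s1]
    supplies [N < 1]. *)
Lemma angle_bound a w : odom As w -> (forall b, '[w, X b] = 0) ->
  `|rdot (As (X a)) (As w)| <= s * nrm (As (X a)) * nrm (As w).
Proof.
move=> Dw wX; have zW := inv_image_orthogonal Dw wX.
have Va : V (As (X a)) by exists (X a); [exists a|].
move: s1; rewrite /s sin_max_principal_angle.
have [_ _|_ N1] := leP (opnorm (fun x => oproj V (x - oproj W x))).
  exact: first_angle_bound.
exact: second_angle_bound.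
Qed.

End Angle.

(** * Eigenvectors *)

Section EigenvectorChoice.
Variables (R : realType) (E : hilbertSpace R).
Variables (A : operator E) (lam : nat -> \bar R) (i : nat -> nat).
Hypothesis sA : selfadjoint A.
Hypothesis lamP : discrete_eigenvalues A lam.
Hypothesis i_inj : injective i.

Lemma conj_realC (a : R) : Num.conj a%:C = a%:C.
Proof. exact: conjc_real. Qed.

Lemma unit_phase (z : R[i]) : exists2 c : R[i], `|c| = 1 & 0 <= z * c^*.
Proof.
have [->|z0] := eqVneq z 0; first by exists 1; rewrite ?normr1 ?mul0r.
have nz : 0 < `|z| by rewrite normr_gt0.
have [r rE] : exists r : R, `|z| = r%:C by rewrite normc_def; eexists.
have r0 : 0 < r by rewrite -ltcR -rE.
exists (z * r^-1%:C).
  rewrite normrM rE normc_def /= expr0n addr0 sqrtr_sqr gtr0_norm ?invr_gt0//.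
  by rewrite -rmorphM divff// gt_eqF.
rewrite rmorphM /= conj_realC mulrA mulr_ge0 ?mul_conjC_ge0// ler0c invr_ge0.
exact: ltW.
Qed.

Lemma eigenvector_orthogonal s t x y : s != t ->
  op_eigenspace A s%:C x -> op_eigenspace A t%:C y -> '[x, y] = 0.
Proof.
move=> st [Dx Ax] [Dy Ay]; have := selfadjoint_hdot sA Dx Dy.
rewrite Ax Ay linearZl_LR linearZr_LR /= conj_realC => /eqP.
rewrite -subr_eq0 -mulrBl -rmorphB mulf_eq0 => /orP[|/eqP//].
by rewrite (inj_eq (@complexI _) _ 0) subr_eq0 (negPf st).
Qed.

Lemma multiplicity_le t m (s : seq nat) : uniq s ->
  (forall j, j \in s -> lam (i j) = t%:E) ->
  ([set k | lam k = t%:E] #= `I_m)%card -> (size s <= m)%N.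
Proof.
move=> us sP Sm; rewrite -card_le_II -(card_le_eqr Sm).
have finj : {in `I_(size s) &, injective (fun k => i (nth 0%N s k))}.
  move=> k k'; rewrite !inE => ks ks' /i_inj /eqP.
  by rewrite nth_uniq// => /eqP.
rewrite -(card_le_eql (inj_card_eq finj)); apply: subset_card_le.
by move=> _ [k ks <-] /=; apply: sP; exact: mem_nth.
Qed.

Lemma eigenvector_extend t m (s : seq nat) (v : nat -> E) (u : E) :
  has_dim (op_eigenspace A t%:C) m -> (size s < m)%N ->
  exists y, [/\ op_eigenspace A t%:C y, '[y, y] = 1, 0 <= '[u, y] &
    forall j, j \in s -> '[y, v j] = 0].
Proof.
move=> [b [bfree bE]] sm.
pose M := \matrix_(l < m, k < size s) '[b l, v (nth 0%N s k)].
(* There are more basis vectors than orthogonality conditions, so some nonzero combination meets all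
   of them. *)
have /rowV0Pn[a /sub_kermxP aM a0] : kermx M != 0.
  by rewrite -mxrank_eq0 mxrank_ker subn_eq0 -ltnNge (leq_ltn_trans (rank_leq_col _)).
pose y := \sum_l a 0 l *: b l.
have y0 : y != 0.
  apply: contra_neq a0 => /bfree a0; apply/rowP => l; rewrite mxE; exact: a0.
have eig (c : R[i]) : op_eigenspace A t%:C (c *: y).
  rewrite bE; exists (fun l => c * a 0 l) => //.
  by rewrite /y scaler_sumr; apply: eq_bigr => l _; rewrite scalerA.
have yv j : j \in s -> '[y, v j] = 0.
  move=> js; have ks : (index j s < size s)%N by rewrite index_mem.
  have /rowP/(_ (Ordinal ks)) := aM; rewrite !mxE => aM0.
  rewrite /y linear_sumlz -[RHS]aM0.
  by apply: eq_bigr => l _; rewrite linearZl_LR /= mxE nth_index.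
have [c c1 cP] := unit_phase '[u, y].
have ny : 0 < nrm y by rewrite lt_def nrm_eq0 y0 nrm_ge0.
exists (((nrm y)^-1%:C * c) *: y); split=> //.
- rewrite hdotE normrZ normrM c1 mulr1 normE normc_def /= expr0n addr0 sqrtr_sqr.
  by rewrite ger0_norm ?invr_ge0 ?nrm_ge0// -rmorphM mulVf ?gt_eqF// expr1n.
- rewrite linearZr_LR /= rmorphM /= conj_realC -mulrA mulr_ge0//.
    by rewrite ler0c invr_ge0 nrm_ge0.
  by rewrite mulrC.
- by move=> j js; rewrite linearZl_LR /= yv// mulr0.
Qed.

Lemma eigenvector_family n (u : 'I_n -> E) :
  (forall j : 'I_n, (lam (i j) < lambda_e A)%E) ->
  exists v : 'I_n -> E, [/\ orthonormal_family v,
    forall j : 'I_n, op_eigenspace A (fine (lam (i j)))%:C (v j) &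
    forall j : 'I_n, 0 <= '[u j, v j]].
Proof.
move=> lame; have [_ lam_bnd _] := lamP.
pose t j := fine (lam (i j)).
have tE j : (j < n)%N -> lam (i j) = (t j)%:E.
  move=> jn; rewrite /t fineK// ge0_fin_numE; last by have /andP[] := lam_bnd (i j).
  exact: lt_le_trans (lame (Ordinal jn)) (leey _).
pose u' j := oapp u 0 (insub j).
have ex : forall p, (p <= n)%N -> exists v : nat -> E, [/\
    forall j k, (j < p)%N -> (k < p)%N -> '[v j, v k] = (j == k)%:R,
    forall j, (j < p)%N -> op_eigenspace A (t j)%:C (v j) &
    forall j, (j < p)%N -> 0 <= '[u' j, v j]].
  elim=> [_|p IH pn]; first by exists (fun=> 0).
  have [v [vo vA vu]] := IH (ltnW pn).
  have [m [dimm cardm]] : exists m, has_dim (op_eigenspace A (t p)%:C) m /\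
     ([set k | lam k = (t p)%:E] #= `I_m)%card.
    by apply: lam_dim => //; rewrite -tE//; exact: lame (Ordinal pn).
  pose s := [seq j <- iota 0 p | t j == t p].
  (* The indices in [s] together with [p] itself occupy distinct places of the eigenvalue [t p], so
     there is room for one more vector. *)
  have sm : (size s < m)%N.
    apply: (@multiplicity_le (t p) m (p :: s)) => //=.
      by rewrite /s filter_uniq ?iota_uniq// mem_filter mem_iota add0n ltnn !andbF.
    move=> j; rewrite inE mem_filter mem_iota add0n => /predU1P[->|]; first exact: tE.
    by move=> /andP[/eqP <- jp]; rewrite tE// (ltn_trans jp).
  have [y [yA yy uy yv]] := eigenvector_extend v (u' p) dimm sm.
  have yo j : (j < p)%N -> '[y, v j] = 0.
    move=> jp; have [tj|tj] := eqVneq (t j) (t p).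
      by apply: yv; rewrite mem_filter tj eqxx mem_iota.
    by apply: eigenvector_orthogonal yA (vA j jp); rewrite eq_sym.
  exists (fun j => if j == p then y else v j); split=> [j k|j|j].
  - rewrite !ltnS (leq_eqVlt j) (leq_eqVlt k) => /predU1P[->|jp] /predU1P[->|kp].
    + by rewrite eqxx.
    + by rewrite !(ltn_eqF kp) (gtn_eqF kp) eqxx; exact: yo.
    + by rewrite !(ltn_eqF jp) eqxx hdotC yo// conjc0.
    + by rewrite !(ltn_eqF jp) !(ltn_eqF kp) vo.
  - by rewrite ltnS leq_eqVlt => /predU1P[->|jp]; rewrite ?eqxx// (ltn_eqF jp); exact: vA.
  - by rewrite ltnS leq_eqVlt => /predU1P[->|jp]; rewrite ?eqxx// (ltn_eqF jp); exact: vu.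
have [v [vo vA vu]] := ex n (leqnn n).
exists (fun j => v j); split=> [j k|j|j].
- by rewrite vo.
- exact: vA.
- by have := vu j (ltn_ord j); rewrite /u' valK.
Qed.

End EigenvectorChoice.

(** * The residual equation for a Ritz vector *)

Section Residual.
Variables (R : realType) (E : hilbertSpace R) (n : nat).
Variable X : {linear 'cV[R[i]]_n -> E}.
Variables H Hs : operator E.
Hypothesis X_iso : isometric X.
Hypothesis sHs : selfadjoint Hs.
Hypothesis HsH : op_eq (op_square Hs) H.
Hypothesis X_dom : forall a, odom Hs (X a).
Variable s : R.
Hypothesis s01 : 0 <= s < 1.
Hypothesis angle : forall a w, odom Hs w -> (forall b, '[w, X b] = 0) ->
  `|rdot (Hs (X a)) (Hs w)| <= s * nrm (Hs (X a)) * nrm (Hs w).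
Variables (a : 'cV[R[i]]_n) (mu : R).
Hypothesis ritz : forall w, odom Hs w ->
  rdot (Hs (X a)) (Hs (range_proj X w)) = mu * rdot (X a) w.

Lemma ritz_energy : rdot (Hs (X a)) (Hs (X a)) = mu * rdot (X a) (X a).
Proof. by rewrite -[in LHS](range_projK X_iso a) -ritz// !range_projK. Qed.

Lemma residual_bound f : nrm (X a) = 1 -> odom H f ->
  (1 - s) * rdot (X a) (H f - mu%:C *: f) ^+ 2 <= s ^+ 2 * (mu * rdot (H f) f).
Proof.
move=> Xa1 Df; have /andP[s0 s1] := s01; have s1' : 0 <= 1 - s by rewrite subr_ge0 ltW.
have [Dsf Dssf] := (op_square_dom HsH f).1 Df; rewrite (op_square_fun HsH Df).
pose p := range_proj X f; pose w := f - p.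
have Dp : odom Hs p by exact: X_dom.
have [Dw Hsw] := real_linear_onB (selfadjoint_real_linear sHs) Dsf Dp.
have wX b : '[w, X b] = 0 by exact: hdot_range_proj.
have HsfE : Hs f = Hs p + Hs w by rewrite Hsw addrC subrK.
have -> : rdot (X a) (Hs (Hs f) - mu%:C *: f) = rdot (Hs (X a)) (Hs w).
  rewrite rdotBr rdotZr -(selfadjoint_sym sHs (X_dom a) Dssf) HsfE rdotDr ritz//.
  by rewrite addrAC subrr add0r.
have energy : rdot (Hs (Hs f)) f = rdot (Hs f) (Hs f) by rewrite (selfadjoint_sym sHs).
(* With [P = |Hs p|] and [Q = |Hs w|], the energy is at least [P^2 - 2 s P Q + Q^2 = (P - s Q)^2 +
   (1 - s^2) Q^2], and [1 - s^2 >= 1 - s]. *)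
have q_le : (1 - s) * nrm (Hs w) ^+ 2 <= rdot (Hs (Hs f)) f.
  rewrite energy HsfE; have := angle (adj X f) Dw wX; rewrite ler_norml => /andP[+ _].
  rewrite -/(range_proj X f) -/p !rdotE (rdotC (Hs w) (Hs p)) !rdotxx.
  have := sqr_ge0 (nrm (Hs p) - s * nrm (Hs w)).
  have := mulr_ge0 (mulr_ge0 s0 s1') (sqr_ge0 (nrm (Hs w))).
  by move: (nrm (Hs p)) (nrm (Hs w)) (rdot (Hs p) (Hs w)) => P Q r; nra.
have mu0 : nrm (Hs (X a)) ^+ 2 = mu by rewrite -rdotxx ritz_energy rdotxx Xa1 expr1n mulr1.
have := angle a Dw wX; rewrite -ler_sqr ?nnegrE ?mulr_ge0 ?nrm_ge0//.
rewrite real_normK ?num_real// !exprMn mu0 => r_le.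
apply: le_trans (ler_wpM2l s1' r_le) _.
have mu_ge0 : 0 <= mu by rewrite -mu0 sqr_ge0.
have := ler_wpM2l (mulr_ge0 (sqr_ge0 s) mu_ge0) q_le; lra.
Qed.

End Residual.

Section Closeness.
Variables (R : realType) (E : hilbertSpace R).
Implicit Types (u v : E) (c : R).

Lemma unit_dist u v c : nrm u = 1 -> nrm v = 1 -> '[u, v] = c%:C ->
  nrm (v - u) ^+ 2 = 2 - 2 * c.
Proof.
move=> u1 v1 uv; have uvr : rdot u v = c by rewrite /rdot uv.
by rewrite -rdotxx !rdotE (rdotC v u) uvr !rdotxx u1 v1; ring.
Qed.

(** Since [|u - c v|^2 = 1 - c^2], this is [1 - c <= (1 - c)(1 + c)]. *)
Lemma unit_dist_residual u v c : nrm u = 1 -> nrm v = 1 -> '[u, v] = c%:C -> 0 <= c ->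
  nrm (v - u) ^+ 2 <= 2 * nrm (u - c%:C *: v) ^+ 2.
Proof.
move=> u1 v1 uv c0; have uvr : rdot u v = c by rewrite /rdot uv.
have c1 : c <= 1 by have := rdot_le u v; rewrite uvr u1 v1 mulr1.
have c1' : 0 <= 1 - c by lra.
rewrite (unit_dist u1 v1 uv) -rdotxx !rdotE (rdotC v u) uvr !rdotxx u1 v1.
by have := mulr_ge0 c0 c1'; lra.
Qed.

End Closeness.

Section SimpleEigenvalue.
Variables (R : realType) (E : hilbertSpace R).
Implicit Types (u v x : E).

Lemma one_dim_multiple (V : set E) v x : has_dim V 1 -> V v -> v != 0 -> V x ->
  exists d : R[i], x = d *: v.
Proof.
move=> [b [_ ->]] [c _ <-]; rewrite big_ord1 => cb0 [d _ <-]; rewrite big_ord1.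
have c0 : c ord0 != 0 by apply: contra_neq cb0 => ->; rewrite scale0r.
by exists (d ord0 / c ord0); rewrite scalerA divfK.
Qed.

Lemma residual_eigenortho (A : operator E) (l c : R) u v :
  has_dim (op_eigenspace A l%:C) 1 -> op_eigenspace A l%:C v -> '[v, v] = 1 ->
  '[u, v] = c%:C -> eigenortho A l (u - c%:C *: v).
Proof.
move=> dim1 Av vv uv x Ax; have v0 : v != 0.
  by apply: contra_eq_neq vv => ->; rewrite linear0l eq_sym oner_eq0.
have [d ->] := one_dim_multiple dim1 Av v0 Ax.
by rewrite /rdot linearZr_LR /= hdotBl linearZl_LR /= vv mulr1 uv subrr mulr0.
Qed.

Lemma simple_dim (A : operator E) (lam : nat -> \bar R) (i : nat -> nat) j (l : R) :
  discrete_eigenvalues A lam -> bijective i -> (l%:E < lambda_e A)%E ->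
  lam (i j) = l%:E -> (forall k, k != j -> lam (i k) <> l%:E) ->
  has_dim (op_eigenspace A l%:C) 1.
Proof.
move=> lamP [i' i'K iK] le lamj simple; have [m [dimm cardm]] := lam_dim lamP le.
suff -> : 1%N = m by [].
apply/card_eq_II; apply: card_eq_trans cardm.
have -> : [set k | lam k = l%:E] = [set i j].
  apply/seteqP; split=> [k|_ ->//] /= lk.
  have [<-|/simple] := eqVneq (i' k) j; first by rewrite iK.
  by rewrite iK.
by rewrite card_eq_sym card_set1.
Qed.

End SimpleEigenvalue.

(** * From squared estimates to the eigenvector bound *)

Section Bound.
Variable R : realType.
Implicit Types (s mu l G d : R) (f : nat -> \bar R).

Lemma sqrt2_bound s G d : 0 <= s < 1 -> 0 <= G -> 0 <= d ->
  (1 - s) * d ^+ 2 <= 2 * (s ^+ 2 * G ^+ 2) ->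
  d <= Num.sqrt 2 * s / Num.sqrt (1 - s) * G.
Proof.
move=> /andP[s0 s1] G0 d0 H; have s1' : 0 < 1 - s by rewrite subr_gt0.
rewrite mulrAC ler_pdivlMr ?sqrtr_gt0//.
rewrite -ler_sqr ?nnegrE ?mulr_ge0 ?sqrtr_ge0// !exprMn !sqr_sqrtr ?(ltW s1')//.
by lra.
Qed.

(* At a multiple eigenvalue the right-hand side is at least [sqrt 2], hence any
   unit eigenvector [v] with [(u, v) >= 0] will do. *)
Lemma multiple_bound s mu l : 0 <= s < 1 -> l != mu -> `|l - mu| <= mu * s ->
  (1 - s) * 2 <= 2 * (s ^+ 2 * fine (gap_ratio mu l%:E) ^+ 2).
Proof.
move=> /andP[s0 s1] lmu H; have d0 : 0 < `|l - mu| by rewrite normr_gt0 subr_eq0.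
have mus : 0 < mu * s := lt_le_trans d0 H.
have mu0 : 0 < mu by rewrite ltNge; apply/negP => mu0; have := mulr_le0_ge0 mu0 s0; lra.
(* The goal amounts to [(1 - s) (l - mu)^2 <= s^2 mu l], which follows from [(l - mu)^2 <= mu^2 s^2]
   and this bound. *)
have l_ge : mu * (1 - s) <= l by move: H; rewrite distrC => /ler_normlW; lra.
have l0 : 0 <= l by apply: le_trans l_ge; apply: mulr_ge0; [exact: ltW|lra].
rewrite /= expr_div_n sqr_sqrtr ?mulr_ge0 ?(ltW mu0)//.
rewrite [leRHS]mulrC ler_pM2r// mulrA ler_pdivlMr ?exprn_gt0//.
have H2 : `|l - mu| ^+ 2 <= (mu * s) ^+ 2 by rewrite ler_sqr ?nnegrE ?normr_ge0 ?(ltW mus).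
apply: le_trans (ler_wpM2l _ H2) _; first by lra.
have := ler_wpM2l (mulr_ge0 (sqr_ge0 s) (ltW mu0)) l_ge; lra.
Qed.

Lemma eigenvector_bound_ge s mu f j d : 0 <= s < 1 ->
  ((forall k, k != j -> f k <> mu%:E) ->
   exists2 G, ((1 - s) * d ^+ 2 <= 2 * (s ^+ 2 * G ^+ 2)) & 0 <= G /\
     (G%:E <= ereal_sup [set gap_ratio mu (f k) | k in [set k | k != j]])%E) ->
  0 <= d -> (d%:E <= eigenvector_bound s mu f j)%E.
Proof.
move=> s01 H d0; rewrite /eigenvector_bound; case: asboolP => [_|nex]; first exact: leey.
have [|G dG [G0 Gsup]] := H; first by move=> k kj fk; apply: nex; exists k.
apply: le_trans (lee_wpmul2l _ Gsup); last first.
  have /andP[s0 s1] := s01.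
  by rewrite lee_fin divr_ge0 ?sqrtr_ge0// mulr_ge0// sqrtr_ge0.
by rewrite -EFinM lee_fin; exact: sqrt2_bound.
Qed.

End Bound.

Theorem theorem6p2 (R : realType) (E : hilbertSpace R)
  (h : hform E) (H Hsqrt H' H'sqrt : operator E)
  (n : nat) (X : {linear 'cV[R[i]]_n -> E})
  (mu : 'I_n -> R) (lam : nat -> \bar R) (i : nat -> nat) (u : 'I_n -> E) :
  let P := range_proj X in
  let ranP := range P in
  let s := sin (max_principal_angle (Hsqrt @` ranP) (inv_image Hsqrt ranP)) in
  form_operator h H Hsqrt ->
  nonneg_definite h H ->
  isometric X ->
  ranP `<=` fdom h ->
  form_operator (block_diagonal h P) H' H'sqrt ->
  sorted_eigenvalues (gram (fun a => Hsqrt (X a))) mu ->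
  (forall j, ((mu j)%:E < lambda_e H)%E) ->
  s < 1 ->
  discrete_eigenvalues H lam ->
  bijective i ->
  (forall j : 'I_n, (lam (i j) < lambda_e H)%E) ->
  (forall j k : 'I_n, (j <= k)%N -> (lam (i j) <= lam (i k))%E) ->
  (forall j : 'I_n, `|fine (lam (i j)) - mu j| <= mu j * s) ->
  (forall j : 'I_n,
     `|fine (lam (i j)) - mu j| <= fine (lam (i j)) * (s / (1 - s))) ->
  (forall j, ranP (u j)) ->
  orthonormal_family u ->
  (forall j, op_eigenspace (op_precomp H' P) (mu j)%:C (u j)) ->
  exists v : 'I_n -> E,
    [/\ orthonormal_family v,
        forall j : 'I_n, op_eigenspace H (fine (lam (i j)))%:C (v j) &
        forall j : 'I_n,
          ((nrm (v j - u j))%:E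
             <= eigenvector_bound s (mu j) (fun k => lam (i k)) j)%E].
Proof.
move=> P ranP s [[sH _] [[sHs _] HsH] Hs_dom hE] [hform le0] X_iso Xdom.
move=> [[sH' _] [[sHs' _] HsH'] Hs'_dom h'E] _ mue s1 lamP i_bij lame _ lam_mu _.
move=> uX uo uH'.
have rangeP : ranP = range X by exact: range_range_proj.
have X_dom a : odom Hsqrt (X a) by rewrite Hs_dom; apply: Xdom; rewrite rangeP; exists a.
have HsqrtB := real_linear_onB (selfadjoint_real_linear sHs).
have Hs0 := real_linear_on0 (selfadjoint_real_linear sHs).
(* Since 0 lies below [lambda_e H], it can belong to the spectrum only as an eigenvalue. *)
have H_inj : (forall x, odom H x -> H x = 0 -> x = 0) -> resolvent_set H 0%:C.
  move=> inj; apply: contrapT => sp0.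
  have [k lamk] := spectrum_below lamP le0 sp0.
  have [x [Dx Hx /eqP x0]] := lam_eigenvector lamP le0 lamk.
  by apply: x0; apply: inj => //; rewrite Hx scale0r.
have sE : s = sin (max_principal_angle (Hsqrt @` range X) (inv_image Hsqrt (range X))).
  by rewrite /s rangeP.
have s0 : 0 <= s by rewrite sE; exact: sin_angle_ge0.
have s01 : 0 <= s < 1 by rewrite s0 s1.
have angle a w : odom Hsqrt w -> (forall b, '[w, X b] = 0) ->
    `|rdot (Hsqrt (X a)) (Hsqrt w)| <= s * nrm (Hsqrt (X a)) * nrm (Hsqrt w).
  move=> Dw wX; rewrite sE; apply: (angle_bound X_iso sHs HsH X_dom H_inj) => //.
  by rewrite -sE.
have i_inj := bij_inj i_bij.
have [v [vo vH vu]] := eigenvector_family sH lamP i_inj u lame.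
exists v; split=> // j; apply: eigenvector_bound_ge => //; last exact: nrm_ge0.
move=> no_mu; pose l := fine (lam (i j)).
have lamj : lam (i j) = l%:E.
  have [_ lam_bnd _] := lamP; rewrite /l fineK// ge0_fin_numE.
    exact: lt_le_trans (lame j) (leey _).
  by have /andP[] := lam_bnd (i j).
have nu : nrm (u j) = 1.
  have := uo j j; rewrite hdotxx eqxx => /complexI /eqP.
  by rewrite -[1 in X in X -> _](expr1n _ 2) eqrXn2 ?nrm_ge0// => /eqP.
have nv : nrm (v j) = 1.
  have := vo j j; rewrite hdotxx eqxx => /complexI /eqP.
  by rewrite -[1 in X in X -> _](expr1n _ 2) eqrXn2 ?nrm_ge0// => /eqP.
have vv : '[v j, v j] = 1 by rewrite hdotxx nv expr1n.
have [c c0 uv] : exists2 c : R, 0 <= c & '[u j, v j] = c%:C.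
  have uv0 := vu j; exists (complex.Re '[u j, v j]); last by rewrite RRe_real ?ger0_real.
  by rewrite -ler0c RRe_real ?ger0_real.
have dist2 := unit_dist nu nv uv.
have le : (l%:E < lambda_e H)%E by rewrite -lamj.
have [[k kj lamk]|simple] := pselect (exists2 k : nat, k != j & lam (i k) = l%:E).
  have lmu : l != mu j.
    by apply/eqP => lmu; apply: (no_mu k kj); rewrite lamk lmu.
  exists (fine (gap_ratio (mu j) l%:E)).
    apply: le_trans (multiple_bound s01 lmu (lam_mu j)).
    by apply: ler_wpM2l; rewrite ?dist2; lra.
  split; first by rewrite -lee_fin -gap_ratio_fin gap_ratio_ge0.
  by rewrite -gap_ratio_fin; apply: ereal_sup_ubound; exists k => //; rewrite lamk.
have dim1 : has_dim (op_eigenspace H l%:C) 1.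
  apply: (simple_dim lamP i_bij le lamj) => k kj lamk; apply: simple.
  by exists k.
have [a _ aE] : range X (u j) by rewrite -rangeP.
(* The eigenvector equation of [H'] tested with [w]; the second block vanishes because [X a] is
   fixed by the projection. *)
have ritz w : odom Hsqrt w ->
    rdot (Hsqrt (X a)) (Hsqrt (range_proj X w)) = mu j * rdot (X a) w.
  move=> Dw; have [/= DPu H'u] := uH' j.
  rewrite /P -aE range_projK// in DPu H'u.
  have [Ds'u Ds's'u] := (op_square_dom HsH' (X a)).1 DPu.
  have Ds'w : odom H'sqrt w by move: Dw; rewrite Hs_dom Hs'_dom.
  have := h'E (X a) w; rewrite -Hs'_dom => /(_ Ds'u Ds'w).
  have DPw : odom Hsqrt (range_proj X w) by exact: X_dom.
  have [DwP _] := HsqrtB w _ Dw DPw.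
  have [D0 _] := HsqrtB _ _ (X_dom a) (X_dom a).
  rewrite /= /P range_projK// !hE -?Hs_dom// subrr Hs0 linear0l addr0.
  move=> HE; rewrite /rdot HE -(selfadjoint_hdot sHs' Ds's'u Ds'w).
  by rewrite -(op_square_fun HsH' DPu) H'u -/(rdot _ w) rdotZl.
have energy := ritz_energy X_iso X_dom ritz.
have mu0 : 0 <= mu j.
  by have := rdot_ge0 (Hsqrt (X a)); rewrite energy aE rdotxx nu expr1n mulr1.
have dist_r := unit_dist_residual nu nv uv c0.
set r := u j - c%:C *: v j in dist_r.
have rN : eigenortho H l r := residual_eigenortho dim1 (vH j) vv uv.
suff [G G0 GE] : exists2 G : R, (1 - s) * nrm r ^+ 2 <= s ^+ 2 * G ^+ 2 & 0 <= G /\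
     (G%:E <= ereal_sup [set gap_ratio (mu j) (lam (i k)) | k in [set k : nat | k != j]])%E.
  have s1' : 0 <= 1 - s by rewrite subr_ge0 ltW.
  exists G; last exact: GE.
  by have := ler_wpM2l s1' dist_r; lra.
have rdotur : rdot (u j) r = nrm r ^+ 2.
  have uvr : rdot (u j) (v j) = c by rewrite /rdot uv.
  by rewrite -rdotxx /r !rdotE (rdotC (v j)) uvr !rdotxx nv; ring.
(* If [mu j = 0], then [l = 0] and [u j] is itself an eigenvector for [l]. Hence [r] is orthogonal
   to [u j], and [|r|^2 = (u j, r) = 0]. *)
have [mu_eq0|mu_neq0] := eqVneq (mu j) 0.
  have Hsu : Hsqrt (u j) = 0.
    by apply/eqP; rewrite -nrm_eq0 -sqrf_eq0 -rdotxx -aE energy mu_eq0 mul0r.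
  have l0 : l = 0.
    have := lam_mu j; rewrite mu_eq0 mul0r normr_le0 subr0 -/l.
    by move/eqP.
  have Hu : op_eigenspace H l%:C (u j).
    have Du : odom H (u j).
      apply/(op_square_dom HsH); rewrite Hsu -aE; split=> //.
      exact: (selfadjoint_real_linear sHs).1.
    by split=> //; rewrite (op_square_fun HsH Du) Hsu Hs0 l0 scale0r.
  exists 0.
    have -> : nrm r ^+ 2 = 0.
      by rewrite -rdotur rdotC; exact: (rN (u j) Hu).
    by rewrite mulr0 expr0n mulr0.
  split=> //; apply: le_trans (gap_ratio_ge0 (mu j) (lam (i j.+1))) _.
  by apply: ereal_sup_ubound; exists j.+1 => //=; rewrite eqn_leq ltnn.
have mu_gt0 : 0 < mu j by rewrite lt_def mu_neq0.
have [G G0 GE] := gap_sup_fin i j lamP mu_gt0 (mue j).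
exists G; last by rewrite GE.
have spG := gap_sup_spectrum lamP i_bij mu_gt0 (mue j) lamj no_mu GE.
have isol := lam_isolated lamP le lamj.
have [f [Df fN fE]] := spectral_gap_solve sH isol mu_gt0 spG rN.
have nXa : nrm (X a) = 1 by rewrite aE.
have resid := residual_bound X_iso sHs HsH X_dom s01 angle ritz nXa Df.
rewrite fE aE rdotur in resid.
have [r0|r0] := eqVneq (nrm r ^+ 2) 0.
  by rewrite r0 mulr0 mulr_ge0 ?sqr_ge0.
have {}r0 : 0 < nrm r ^+ 2 by rewrite lt_def r0 sqr_ge0.
(* [gap_resolvent_bound] needs a constant strictly above [G ^+ 2]; the slack [e] survives the factor
   [s ^+ 2 <= 1], and one factor [|r|^2] cancels. *)
apply/ler_addgt0Pr => e e0; have Ge : G ^+ 2 < G ^+ 2 + e by rewrite ltrDl.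
have := gap_resolvent_bound sH isol mu_gt0 spG Df fN Ge; rewrite fE rdotxx => Hf.
rewrite -(ler_pM2r r0).
have s2 : s ^+ 2 <= 1 by rewrite expr_le1// ltW.
have := ler_wpM2l (sqr_ge0 s) Hf.
have := ler_wpM2r (mulr_ge0 (ltW e0) (ltW r0)) s2; lra.
Qed.
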